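(* Let $G$ be a group and let $$A=\bigoplus_{e\in E}Ae=\bigoplus_{e\in E}eA\qquad\text{and}\qquad B=\bigoplus_{f\in F}Bf=\bigoplus_{f\in F}fB$$ be partially-strongly-$G$-graded algebras with orthogonal local units, where $E\subseteq A$ and $F\subseteq B$ are sets of pairwise orthogonal idempotents. Suppose that $A$ and $B$ are strongly-graded-equivalent. Then for any infinite set of indexes $\mathcal X$ whose cardinality is bigger than or equal to those of $E$ and $F$, there exists a graded isomorphism of algebras $$\mathrm{FMat}_{\mathcal X}(A)\cong\mathrm{FMat}_{\mathcal X}(B).$$
   Context: Algebras are associative, not necessarily unital, over a fixed commutative associative unital ring $k$; $G$ is an arbitrary group. Products of subsets such as $UV$ denote the $k$-span of all products $uv$. An algebra $A$ is idempotent if $A^2=A$. An algebra $A$ (not necessarily graded) has orthogonal local units if there is a set $E$ of (not necessarily central) pairwise orthogonal idempotents in $A$ with $A=\bigoplus_{e\in E}Ae=\bigoplus_{e\in E}eA$. $\mathrm{FMat}_{\mathcal X}(A)$ is the algebra of $\mathcal X\times\mathcal X$-matrices over $A$ with finitely many nonzero entries; for a $G$-graded algebra $A=\bigoplus_gA_g$ it is $G$-graded with $g$-homogeneous component $\mathrm{FMat}_{\mathcal X}(A_g)$, the matrices with entries in $A_g$. A graded isomorphism is an algebra isomorphism preserving the homogeneous components. A $G$-graded algebra $A=\bigoplus_tA_t$ ($A_sA_t\subseteq A_{st}$) is partially-strongly-graded if $A_t=A_tA_{t^{-1}}A_t$ for all $t\in G$. Put $D^A_t:=A_tA_{t^{-1}}$,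 a two-sided ideal of $A_1$. (If $A$ is partially-strongly-graded then $A$ and all $D^A_t$ are idempotent.) A bimodule ${}_RM_S$ is unital if $RM=M=MS$. A Morita context $(A,B,X,Y,\tau_A,\tau_B)$ consists of algebras $A,B$, an $(A,B)$-bimodule $X$, a $(B,A)$-bimodule $Y$, an $A$-bimodule map $\tau_A:X\otimes_BY\to A$ and a $B$-bimodule map $\tau_B:Y\otimes_AX\to B$ with $\tau_A(x\otimes y)x'=x\tau_B(y\otimes x')$ and $\tau_B(y\otimes x)y'=y\tau_A(x\otimes y')$. It is a graded Morita context between idempotent $G$-graded algebras $A,B$ if $X=\bigoplus_tX_t$, $Y=\bigoplus_tY_t$ are $G$-graded bimodules, and $\tau_A(X_r\otimes_B Y_s)\subseteq A_{rs}$, $\tau_B(Y_r\otimes_A X_s)\subseteq B_{rs}$ for all $r,s\in G$. Suppose all $D^A_t,D^B_t$ are idempotent. A graded Morita context is strong if each $X_t$ is a unital $(D^A_t,D^B_{t^{-1}})$-bimodule and each $Y_t$ is a unital $(D^B_t,D^A_{t^{-1}})$-bimodule. The idempotent graded algebras $A$ and $B$ are strongly-graded-equivalent if there is a strong graded Morita context with $\tau_A,\tau_B$ surjective such that, for all $t\in G$, the $k$-span of $\{\tau_A(x\otimes y):x\in X_t,y\in Y_{t^{-1}}\}$ is $D^A_t$ and the $k$-span of $\{\tau_B(y\otimes x):y\in Y_t,x\in X_{t^{-1}}\}$ is $D^B_t$. *)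

(* Defs.v *)
From HB Require Import structures.
From mathcomp Require Import all_boot all_order all_algebra.
From mathcomp Require Import generic_quotient ring_quotient finmap.
From mathcomp Require Import boolp classical_sets functions cardinality fsbigop.
Set Implicit Arguments.
Unset Strict Implicit.
Unset Printing Implicit Defensive.
Import GRing.Theory.
Local Open Scope classical_set_scope.
Local Open Scope quotient_scope.
Local Open Scope ring_scope.

(* Associative, not necessarily unital, k-algebras. *)
HB.mixin Record Lmodule_isNUAlgebra (k : comPzRingType) A
    of GRing.Lmodule k A := {
  nmul : A -> A -> A;
  nmulA : associative nmul;
  nmulDl : left_distributive nmul +%R;
  nmulDr : right_distributive nmul +%R;
  nmulZl : forall (c : k) a b, nmul (c *: a) b = c *: nmul a b;
  nmulZr : forall (c : k) a b, nmul a (c *: b) = c *: nmul a b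
}.
#[short(type="nuAlgType")]
HB.structure Definition NUAlgebra (k : comPzRingType) :=
  {A of Lmodule_isNUAlgebra k A & GRing.Lmodule k A}.

HB.mixin Record Lmodule_isBimodule (k : comPzRingType) (A B : nuAlgType k) M
    of GRing.Lmodule k M := {
  lact : A -> M -> M;
  ract : M -> B -> M;
  lactA : forall a b x, lact (nmul a b) x = lact a (lact b x);
  lactDl : forall a b x, lact (a + b) x = lact a x + lact b x;
  lactDr : forall a x y, lact a (x + y) = lact a x + lact a y;
  lactZl : forall (c : k) a x, lact (c *: a) x = c *: lact a x;
  lactZr : forall (c : k) a x, lact a (c *: x) = c *: lact a x;
  ractA : forall x b c, ract x (nmul b c) = ract (ract x b) c;
  ractDl : forall x y b, ract (x + y) b = ract x b + ract y b;
  ractDr : forall x b c, ract x (b + c) = ract x b + ract x c;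
  ractZl : forall (c : k) x b, ract (c *: x) b = c *: ract x b;
  ractZr : forall (c : k) x b, ract x (c *: b) = c *: ract x b;
  lractA : forall a x b, ract (lact a x) b = lact a (ract x b)
}.
#[short(type="bimodType")]
HB.structure Definition Bimodule (k : comPzRingType) (A B : nuAlgType k) :=
  {M of Lmodule_isBimodule k A B M & GRing.Lmodule k M}.

Section Spans.
Variable k : comPzRingType.

Definition is_submodule (M : lmodType k) (V : set M) : Prop :=
  V 0 /\ forall (c : k) u v, V u -> V v -> V (c *: u + v).

Definition span (M : lmodType k) (S : set M) : set M :=
  smallest (@is_submodule M) S.

(* The product U V of subsets: the k-span of all op u v. *)
Definition spanprod (M N : Type) (P : lmodType k) (op : M -> N -> P)
    (U : set M) (V : set N) : set P :=
  span [set op u v | u in U & v in V].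

Lemma span_submodule (M : lmodType k) (S : set M) : is_submodule (span S).
Proof.
split=> [V [[V0 _] _] //|c u v Su Sv V [sV SV]].
by apply: sV.2; [exact: Su | exact: Sv].
Qed.

Lemma sub_span (M : lmodType k) (S : set M) : S `<=` span S.
Proof. by move=> x Sx V [_]; apply. Qed.

Lemma span_min (M : lmodType k) (S V : set M) :
  is_submodule V -> S `<=` V -> span S `<=` V.
Proof. by move=> sV SV x; apply. Qed.

End Spans.

Section FinSupp.
Variables (k : comPzRingType) (T : Type) (M : lmodType k).

Definition finsupp_pred (f : T -> M) : bool :=
  `[< finite_set [set t | f t != 0] >].

Record finsupp := FinSupp { fsval :> T -> M; _ : finsupp_pred fsval }.

HB.instance Definition _ := [isSub for fsval].
HB.instance Definition _ := gen_eqMixin finsupp.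
HB.instance Definition _ := gen_choiceMixin finsupp.

Lemma finsupp_submod : GRing.subsemimod_closed finsupp_pred.
Proof.
split=> [|c f /asboolP fF]; last first.
  apply/asboolP; apply: sub_finite_set fF => t /=.
  by apply: contraNN => /eqP ft0; rewrite fctE ft0 scaler0.
split=> [|f g /asboolP fF /asboolP gF]; apply/asboolP.
  by apply: (@sub_finite_set _ _ set0) => // t /=; rewrite eqxx.
apply: (@sub_finite_set _ _ ([set t | f t != 0] `|` [set t | g t != 0])).
  move=> t /=; case: (eqVneq (f t) 0) => [f0|]; last by left.
  by rewrite fctE f0 add0r; right.
by rewrite finite_setU.
Qed.

HB.instance Definition _ := GRing.SubChoice_isSubLmodule.Build k (T -> M)
  finsupp_pred finsupp finsupp_submod.

Lemma finsuppP (f : finsupp) : finite_set [set t | f t != 0].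
Proof. by case: f => f /= /asboolP. Qed.

End FinSupp.
Arguments finsupp {k} T M.

Section FinSuppSums.
Variables (k : comPzRingType).

Lemma finsupp_fset (T : choiceType) (M : lmodType k) (f : finsupp T M) :
  exists S : {fset T}, forall t, t \notin S -> f t = 0.
Proof.
exists (fset_set [set t | f t != 0]) => t.
rewrite in_fset_set; last exact: finsuppP.
by rewrite notin_setE /= => /negP; rewrite negbK => /eqP.
Qed.

Definition finsupp_delta (T : choiceType) (t : T) : finsupp T k^o.
Proof.
refine (@FinSupp k T k^o (fun u => if u == t then 1 else 0) _).
apply/asboolP; apply: (sub_finite_set _ (finite_set1 t)) => u /=.
by case: (eqVneq u t) => // _; rewrite eqxx.
Defined.

(* The k-linear extension of phi to the free k-module on T. *)
Definition free_ext (T : choiceType) (M : lmodType k) (phi : T -> M)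
    (f : finsupp T k^o) : M :=
  \sum_(t \in [set: T]) (f t : k) *: phi t.

Lemma free_extE (T : choiceType) (M : lmodType k) (phi : T -> M)
    (f : finsupp T k^o) (S : {fset T}) : (forall t, t \notin S -> f t = 0) ->
  free_ext phi f = \sum_(t <- S) (f t : k) *: phi t.
Proof. by move=> fS; apply: fsbigTE => t /fS ->; rewrite scale0r. Qed.

Lemma free_ext_linear (T : choiceType) (M : lmodType k) (phi : T -> M) :
  linear (free_ext phi).
Proof.
move=> c f g; have [S fS] := finsupp_fset f; have [U gU] := finsupp_fset g.
have fSU t : t \notin (S `|` U)%fset -> f t = 0.
  by rewrite inE negb_or => /andP[/fS].
have gSU t : t \notin (S `|` U)%fset -> g t = 0.
  by rewrite inE negb_or => /andP[_ /gU].
rewrite (free_extE _ fSU) (free_extE _ gSU) (@free_extE _ _ _ _ (S `|` U)%fset).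
  rewrite scaler_sumr -big_split; apply: eq_bigr => t _ /=.
  by rewrite scalerA -scalerDl.
move=> t nt; transitivity (c *: f t + g t) => //.
by rewrite fSU // gSU // scaler0 addr0.
Qed.

Lemma free_ext_delta (T : choiceType) (M : lmodType k) (phi : T -> M) t :
  free_ext phi (finsupp_delta t) = phi t.
Proof.
rewrite (@free_extE _ _ _ _ [fset t]%fset) => [|u].
  by rewrite big_seq_fset1 /= eqxx scale1r.
by rewrite inE /= => /negPf ->.
Qed.

Lemma free_ext_id (T : choiceType) (f : finsupp T k^o) :
  free_ext (@finsupp_delta T) f = f.
Proof.
have [S fS] := finsupp_fset f; rewrite (free_extE _ fS).
apply/val_inj/funext => t /=.
rewrite (big_morph (fun g : finsupp T k^o => g t) (op1 := +%R) (id1 := 0)) //=.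
transitivity (\sum_(u <- S) (f u : k) * (if t == u then 1 else 0)).
  exact: eq_bigr.
have [tS|tS] := boolP (t \in S).
  rewrite (big_fsetD1 t) //= eqxx mulr1 big_seq big1 ?addr0 // => u.
  by rewrite !inE eq_sym => /andP[/negPf -> _]; rewrite mulr0.
rewrite fS // big_seq big1 // => u uS.
by case: eqP => [tu|_]; [rewrite tu uS in tS|rewrite mulr0].
Qed.

End FinSuppSums.

Section SpanQuotient.
Variables (k : comPzRingType) (M : lmodType k) (S : set M).

Definition span_pred : {pred M} := fun x => `[< span S x >].

Lemma span_predZ : GRing.subsemimod_closed span_pred.
Proof.
have [S0 SD] := span_submodule S; split=> [|c x /asboolP Sx]; last first.
  by apply/asboolP; rewrite -[c *: x]addr0; exact: SD.
split=> [|x y /asboolP Sx /asboolP Sy]; apply/asboolP => //.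
by rewrite -[x]scale1r; exact: SD.
Qed.

HB.instance Definition _ := GRing.isSubmodClosed.Build k M span_pred span_predZ.

Definition span_quot : Type := Quotient.quot span_pred.

HB.instance Definition _ := GRing.Zmodule.on span_quot.

Definition span_pi (x : M) : span_quot := \pi_(Quotient.quot span_pred) x.

Definition span_repr (q : span_quot) : M := repr (q : Quotient.quot span_pred).

Lemma span_reprK : cancel span_repr span_pi.
Proof. by move=> q; exact: (@reprK _ (Quotient.quot span_pred)). Qed.

Lemma span_piE (x y : M) : span_pi x = span_pi y <-> span S (x - y).
Proof.
split=> [/eqP|Sxy].
  by rewrite /span_pi -(Quotient.idealrBE span_pred) => /asboolP.
by apply/eqP; rewrite /span_pi -(Quotient.idealrBE span_pred); apply/asboolP.
Qed.

Lemma span_piD : {morph span_pi : x y / x + y}.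
Proof. by move=> x y; rewrite /span_pi; exact: (raddfD \pi_(Quotient.quot span_pred)). Qed.

Definition span_scale (c : k) (q : span_quot) : span_quot :=
  span_pi (c *: span_repr q).

Lemma span_piZ (c : k) (x : M) : span_pi (c *: x) = span_scale c (span_pi x).
Proof.
apply/span_piE; rewrite -scalerBr -[_ *: _]addr0.
have [S0 SD] := span_submodule S; apply: SD => //.
by apply/span_piE; rewrite span_reprK.
Qed.

Fact span_scaleA a b v : span_scale a (span_scale b v) = span_scale (a * b) v.
Proof. by rewrite -[v]span_reprK -!span_piZ scalerA. Qed.
Fact span_scale1 : left_id 1 span_scale.
Proof. by move=> v; rewrite -[v]span_reprK -span_piZ scale1r. Qed.
Fact span_scaleDr : right_distributive span_scale +%R.
Proof.
move=> a u v; rewrite -[u]span_reprK -[v]span_reprK.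
by rewrite -span_piD -!span_piZ -span_piD scalerDr.
Qed.
Fact span_scaleDl v : {morph span_scale^~ v : a b / a + b}.
Proof.
by move=> a b; rewrite -[v]span_reprK -!span_piZ -span_piD scalerDl.
Qed.

HB.instance Definition _ := GRing.Zmodule_isLmodule.Build k span_quot
  span_scaleA span_scale1 span_scaleDr span_scaleDl.

Lemma span_pi_linear : linear span_pi.
Proof. by move=> c u v; rewrite span_piD span_piZ. Qed.

End SpanQuotient.

(* Tensor product of a right B-module and a left B-module: the free k-module on
   X * Y modulo k-bilinearity and B-balancedness. *)
Section Tensor.
Variables (k : comPzRingType) (A B C : nuAlgType k).
Variables (X : bimodType A B) (Y : bimodType B C).

Let d (x : X) (y : Y) : finsupp (X * Y)%type k^o := finsupp_delta k (x, y).

Definition tensor_rel : set (finsupp (X * Y)%type k^o) := fun f =>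
  [\/ exists x x' y, f = d (x + x') y - (d x y + d x' y),
      exists x y y', f = d x (y + y') - (d x y + d x y'),
      exists c x y, f = d (c *: x) y - c *: d x y
    | (exists c x y, f = d x (c *: y) - c *: d x y) \/
      exists x b y, f = d (ract x b) y - d x (lact b y)].

Definition tensor : Type := span_quot tensor_rel.
HB.instance Definition _ := GRing.Lmodule.on tensor.

Definition tens (x : X) (y : Y) : tensor := span_pi tensor_rel (d x y).

Let piB (u v : finsupp (X * Y)%type k^o) :
  tensor_rel (u - v) -> span_pi tensor_rel u = span_pi tensor_rel v.
Proof. by move=> uv; apply/span_piE; exact: sub_span. Qed.

Lemma tensDl x x' y : tens (x + x') y = tens x y + tens x' y.
Proof.
rewrite /tens -[RHS]span_piD; apply: piB.
by apply: Or41; exists x, x', y.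
Qed.

Lemma tensDr x y y' : tens x (y + y') = tens x y + tens x y'.
Proof.
rewrite /tens -[RHS]span_piD; apply: piB.
by apply: Or42; exists x, y, y'.
Qed.

Lemma tensZl c x y : tens (c *: x) y = c *: tens x y.
Proof.
rewrite /tens -[RHS]span_piZ; apply: piB.
by apply: Or43; exists c, x, y.
Qed.

Lemma tensZr c x y : tens x (c *: y) = c *: tens x y.
Proof.
rewrite /tens -[RHS]span_piZ; apply: piB.
by apply: Or44; left; exists c, x, y.
Qed.

Lemma tens_balanced x b y : tens (ract x b) y = tens x (lact b y).
Proof. by apply: piB; apply: Or44; right; exists x, b, y. Qed.

Definition balanced (Z : lmodType k) (phi : X -> Y -> Z) : Prop :=
  [/\ forall y, linear (phi^~ y), forall x, linear (phi x)
    & forall x b y, phi (ract x b) y = phi x (lact b y)].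

Definition tensor_lift (Z : lmodType k) (phi : X -> Y -> Z) (t : tensor) : Z :=
  free_ext (fun p => phi p.1 p.2) (span_repr t).

Section Lift.
Variables (Z : lmodType k) (phi : X -> Y -> Z).
Hypothesis phi_bal : balanced phi.
Let ext := free_ext (fun p : X * Y => phi p.1 p.2).

Let ext_lin : linear ext := free_ext_linear (fun p : X * Y => phi p.1 p.2).

Let extD u v : ext (u + v) = ext u + ext v.
Proof. by have := ext_lin 1 u v; rewrite !scale1r. Qed.
Let ext0 : ext 0 = 0.
Proof. by apply: (addrI (ext 0)); rewrite -extD !addr0. Qed.
Let extZ c u : ext (c *: u) = c *: ext u.
Proof. by have := ext_lin c u 0; rewrite ext0 !addr0. Qed.
Let extB u v : ext (u - v) = ext u - ext v.
Proof. by rewrite extD -[- v]scaleN1r extZ scaleN1r. Qed.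
Let extd x y : ext (d x y) = phi x y.
Proof. exact: free_ext_delta. Qed.

Let lin2 (U V : lmodType k) (h : U -> V) : linear h ->
  (forall u v, h (u + v) = h u + h v) * (forall c u, h (c *: u) = c *: h u).
Proof.
move=> hl; have hD u v : h (u + v) = h u + h v.
  by have := hl 1 u v; rewrite !scale1r.
split=> // c u; have h0 : h 0 = 0.
  by apply: (addrI (h 0)); rewrite -hD !addr0.
by have := hl c u 0; rewrite h0 !addr0.
Qed.

Let ext_rel f : span tensor_rel f -> ext f = 0.
Proof.
have [phil phir phib] := phi_bal.
apply: (@span_min _ _ _ [set g | ext g = 0]) => [|g].
  by split=> [|c u v u0 v0]; [exact: ext0 | rewrite /= ext_lin u0 v0 scaler0 addr0].
case=> [[x [x' [y ->]]]|[x [y [y' ->]]]|[c [x [y ->]]]|[[c [x [y ->]]]|[x [b [y ->]]]]].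
- by rewrite /= extB extD !extd (lin2 (phil y)).1 subrr.
- by rewrite /= extB extD !extd (lin2 (phir x)).1 subrr.
- by rewrite /= extB extZ !extd (lin2 (phil y)).2 subrr.
- by rewrite /= extB extZ !extd (lin2 (phir x)).2 subrr.
- by rewrite /= extB !extd phib subrr.
Qed.

Lemma tensor_lift_pi u : tensor_lift phi (span_pi tensor_rel u) = ext u.
Proof.
apply/eqP; rewrite -subr_eq0 -[X in X - _]/(ext _) -extB; apply/eqP/ext_rel.
by apply/span_piE; rewrite span_reprK.
Qed.

Lemma tensor_lift_linear : linear (tensor_lift phi).
Proof.
move=> c t u; rewrite -[t]span_reprK -[u]span_reprK -span_pi_linear.
by rewrite !tensor_lift_pi; exact: free_ext_linear.
Qed.

Lemma tensor_liftE x y : tensor_lift phi (tens x y) = phi x y.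
Proof. by rewrite tensor_lift_pi extd. Qed.

End Lift.

Lemma tensor_ind (P : set tensor) : is_submodule P ->
  (forall x y, P (tens x y)) -> forall t, P t.
Proof.
move=> [P0 PD] Pt t; rewrite -[t]span_reprK -[span_repr t]free_ext_id.
have [S fS] := finsupp_fset (span_repr t); rewrite (free_extE _ fS).
elim/big_ind: _ => [|f g Pf Pg|[x y] _].
- suff -> : span_pi tensor_rel 0 = 0 :> tensor by [].
  by apply: (addrI (span_pi tensor_rel 0)); rewrite -[LHS]span_piD !addr0.
- by rewrite span_piD -[span_pi _ f]scale1r; exact: PD.
- rewrite [span_pi _ _]span_piZ -[span_scale _ _]addr0.
  by apply: PD; [exact: Pt | exact: P0].
Qed.

Lemma tensor_eq (Z : lmodType k) (g h : tensor -> Z) : linear g -> linear h ->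
  (forall x y, g (tens x y) = h (tens x y)) -> g =1 h.
Proof.
move=> gl hl gh t; apply: (@tensor_ind [set t | g t = h t]) => //.
have lin0 (m : tensor -> Z) : linear m -> m 0 = 0.
  move=> ml; apply: (addrI (m 0)); rewrite addr0.
  by have := ml 1 0 0; rewrite !scale1r addr0 => <-.
split=> [|c u v /= guh gvh] /=; first by rewrite !lin0.
by rewrite gl hl guh gvh.
Qed.

Definition tensor_lact (a : A) : tensor -> tensor :=
  tensor_lift (fun x y => tens (lact a x) y).
Definition tensor_ract (t : tensor) (c : C) : tensor :=
  tensor_lift (fun x y => tens x (ract y c)) t.

Let lact_bal a : balanced (fun x y => tens (lact a x) y).
Proof.
split=> [y e u v|x e u v|x b y].
- by rewrite lactDr lactZr tensDl tensZl.
- by rewrite tensDr tensZr.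
- by rewrite -lractA tens_balanced.
Qed.

Let ract_bal c : balanced (fun x y => tens x (ract y c)).
Proof.
split=> [y e u v|x e u v|x b y].
- by rewrite tensDl tensZl.
- by rewrite ractDl ractZl tensDr tensZr.
- by rewrite tens_balanced lractA.
Qed.

Lemma tensor_lactE a x y : tensor_lact a (tens x y) = tens (lact a x) y.
Proof. exact: tensor_liftE (lact_bal a) x y. Qed.

Lemma tensor_ractE x y c : tensor_ract (tens x y) c = tens x (ract y c).
Proof. exact: tensor_liftE (ract_bal c) x y. Qed.

Fact tensor_lact_lin a : linear (tensor_lact a).
Proof. exact: tensor_lift_linear (lact_bal a). Qed.

Fact tensor_ract_lin c : linear (tensor_ract^~ c).
Proof. exact: tensor_lift_linear (ract_bal c). Qed.

Let linD (h : tensor -> tensor) : linear h -> forall u v, h (u + v) = h u + h v.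
Proof. by move=> hl u v; have := hl 1 u v; rewrite !scale1r. Qed.

Let linZ (h : tensor -> tensor) : linear h ->
  forall c u, h (c *: u) = c *: h u.
Proof.
move=> hl c u; have h0 : h 0 = 0.
  by apply: (addrI (h 0)); rewrite -linD // !addr0.
by have := hl c u 0; rewrite h0 !addr0.
Qed.

Let lin_comp (g h : tensor -> tensor) :
  linear g -> linear h -> linear (fun t => g (h t)).
Proof. by move=> gl hl c u v; rewrite hl gl. Qed.

Let lin_add (g h : tensor -> tensor) :
  linear g -> linear h -> linear (fun t => g t + h t).
Proof. by move=> gl hl c u v; rewrite hl gl scalerDr addrACA. Qed.

Let lin_scale (h : tensor -> tensor) e :
  linear h -> linear (fun t => e *: h t).
Proof.
by move=> hl c u v; rewrite hl scalerDr !scalerA [e * c]mulrC.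
Qed.

Fact tensor_lactA a b t :
  tensor_lact (nmul a b) t = tensor_lact a (tensor_lact b t).
Proof.
move: t; apply: tensor_eq; [exact: tensor_lact_lin| |].
  exact: lin_comp (tensor_lact_lin a) (tensor_lact_lin b).
by move=> x y; rewrite !tensor_lactE lactA.
Qed.
Fact tensor_lactDl a b t :
  tensor_lact (a + b) t = tensor_lact a t + tensor_lact b t.
Proof.
move: t; apply: tensor_eq; [exact: tensor_lact_lin| |].
  exact: lin_add (tensor_lact_lin a) (tensor_lact_lin b).
by move=> x y; rewrite !tensor_lactE lactDl tensDl.
Qed.
Fact tensor_lactDr a t u :
  tensor_lact a (t + u) = tensor_lact a t + tensor_lact a u.
Proof. exact: linD (tensor_lact_lin a) t u. Qed.
Fact tensor_lactZl c a t : tensor_lact (c *: a) t = c *: tensor_lact a t.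
Proof.
move: t; apply: tensor_eq; [exact: tensor_lact_lin| |].
  exact: lin_scale (tensor_lact_lin a).
by move=> x y; rewrite !tensor_lactE lactZl tensZl.
Qed.
Fact tensor_lactZr c a t : tensor_lact a (c *: t) = c *: tensor_lact a t.
Proof. exact: linZ (tensor_lact_lin a) c t. Qed.
Fact tensor_ractA t b c :
  tensor_ract t (nmul b c) = tensor_ract (tensor_ract t b) c.
Proof.
move: t; apply: (tensor_eq (tensor_ract_lin _)).
  exact: lin_comp (tensor_ract_lin c) (tensor_ract_lin b).
by move=> x y; rewrite !tensor_ractE ractA.
Qed.
Fact tensor_ractDl t u c :
  tensor_ract (t + u) c = tensor_ract t c + tensor_ract u c.
Proof. exact: linD (tensor_ract_lin c) t u. Qed.
Fact tensor_ractDr t b c :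
  tensor_ract t (b + c) = tensor_ract t b + tensor_ract t c.
Proof.
move: t; apply: (tensor_eq (tensor_ract_lin _)).
  exact: lin_add (tensor_ract_lin b) (tensor_ract_lin c).
by move=> x y; rewrite !tensor_ractE ractDr tensDr.
Qed.
Fact tensor_ractZl e t c : tensor_ract (e *: t) c = e *: tensor_ract t c.
Proof. exact: linZ (tensor_ract_lin c) e t. Qed.
Fact tensor_ractZr e t c : tensor_ract t (e *: c) = e *: tensor_ract t c.
Proof.
move: t; apply: (tensor_eq (tensor_ract_lin _)).
  exact: lin_scale (tensor_ract_lin c).
by move=> x y; rewrite !tensor_ractE ractZr tensZr.
Qed.
Fact tensor_lractA a t c :
  tensor_ract (tensor_lact a t) c = tensor_lact a (tensor_ract t c).
Proof.
move: t; apply: tensor_eq.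
- exact: lin_comp (tensor_ract_lin c) (tensor_lact_lin a).
- exact: lin_comp (tensor_lact_lin a) (tensor_ract_lin c).
by move=> x y; rewrite tensor_lactE !tensor_ractE tensor_lactE.
Qed.

HB.instance Definition _ := Lmodule_isBimodule.Build k A C tensor
  tensor_lactA tensor_lactDl tensor_lactDr tensor_lactZl tensor_lactZr
  tensor_ractA tensor_ractDl tensor_ractDr tensor_ractZl tensor_ractZr
  tensor_lractA.

End Tensor.

Section FMat.
Variables (k : comPzRingType) (X : choiceType) (A : nuAlgType k).

Definition FMat : Type := finsupp (X * X)%type A.
HB.instance Definition _ := GRing.Lmodule.on FMat.

Definition entry (M : FMat) (i j : X) : A := fsval M (i, j).

Let nmul0l (a : A) : nmul 0 a = 0.
Proof. by have := nmulZl 0 (0 : A) a; rewrite !scale0r. Qed.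

Let nmul0r (a : A) : nmul a 0 = 0.
Proof. by have := nmulZr 0 a (0 : A); rewrite !scale0r. Qed.

Let nmul_suml (I : Type) (r : seq I) (F : I -> A) b :
  nmul (\sum_(i <- r) F i) b = \sum_(i <- r) nmul (F i) b.
Proof. exact: (big_morph (nmul^~ b) (fun a c => nmulDl a c b) (nmul0l b)). Qed.

Let nmul_sumr (I : Type) (r : seq I) (F : I -> A) a :
  nmul a (\sum_(i <- r) F i) = \sum_(i <- r) nmul a (F i).
Proof. exact: (big_morph (nmul a) (nmulDr a) (nmul0r a)). Qed.

Lemma FMat_eq (M N : FMat) : (forall i j, entry M i j = entry N i j) -> M = N.
Proof. by move=> MN; apply/val_inj/funext => -[i j]; exact: MN. Qed.

Let rows_cols (M : FMat) : exists S : {fset X},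
  forall i j, (i \notin S) || (j \notin S) -> entry M i j = 0.
Proof.
have [U MU] := finsupp_fset M.
exists ([fset p.1 | p in U] `|` [fset p.2 | p in U])%fset => i j ij.
apply: MU; apply: contraL ij => ijU; rewrite negb_or !negbK !inE.
by apply/andP; split; apply/orP; [left|right]; apply/imfsetP; exists (i, j).
Qed.

Definition fmat_mul_fun (M N : FMat) (p : X * X) : A :=
  \sum_(l \in [set: X]) nmul (entry M p.1 l) (entry N l p.2).

Let fmat_mul_funE (M N : FMat) p (S : {fset X}) :
  (forall i j, (i \notin S) || (j \notin S) -> entry M i j = 0) ->
  fmat_mul_fun M N p = \sum_(l <- S) nmul (entry M p.1 l) (entry N l p.2).
Proof. by move=> MS; apply: fsbigTE => l lS; rewrite MS ?nmul0l // lS orbT. Qed.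

Fact fmat_mul_finsupp (M N : FMat) : finsupp_pred (fmat_mul_fun M N).
Proof.
have [S MS] := rows_cols M; have [U NU] := rows_cols N.
apply/asboolP.
apply: (@sub_finite_set _ _ ([set` S] `*` [set` U])); last exact: finite_setX.
move=> [i j] /= /eqP Mij; split; apply: contra_notT Mij => nij /=.
  by apply: fsbig1 => l _; rewrite MS ?nij // nmul0l.
by apply: fsbig1 => l _; rewrite NU ?nij ?orbT // nmul0r.
Qed.

Definition fmat_mul (M N : FMat) : FMat := FinSupp (fmat_mul_finsupp M N).

Let mulE (M N : FMat) i j (S : {fset X}) :
  (forall i j, (i \notin S) || (j \notin S) -> entry M i j = 0) ->
  entry (fmat_mul M N) i j = \sum_(l <- S) nmul (entry M i l) (entry N l j).
Proof. exact: fmat_mul_funE. Qed.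

Let common (M N P : FMat) : exists S : {fset X},
  forall i j, (i \notin S) || (j \notin S) ->
    [/\ entry M i j = 0, entry N i j = 0 & entry P i j = 0].
Proof.
have [S MS] := rows_cols M; have [U NU] := rows_cols N.
have [V PV] := rows_cols P; exists (S `|` U `|` V)%fset => i j.
rewrite !inE !negb_or => nij; split; [apply: MS|apply: NU|apply: PV].
- by case/orP: nij => /andP[/andP[-> _] _]; rewrite ?orbT.
- by case/orP: nij => /andP[/andP[_ ->] _]; rewrite ?orbT.
- by case/orP: nij => /andP[_ ->]; rewrite ?orbT.
Qed.

Fact fmat_mulA : associative fmat_mul.
Proof.
move=> M N P; have [S SE] := common M N P.
have MS i j : (i \notin S) || (j \notin S) -> entry M i j = 0 by case/SE.
have NS i j : (i \notin S) || (j \notin S) -> entry N i j = 0 by case/SE.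
have MNS i j : (i \notin S) || (j \notin S) -> entry (fmat_mul M N) i j = 0.
  rewrite (mulE _ _ _ MS) => nij; apply: big1 => l _; case/orP: nij => nij.
    by rewrite MS ?nij // nmul0l.
  by rewrite NS ?nij ?orbT // nmul0r.
apply: FMat_eq => i j; rewrite (mulE _ _ _ MS) (mulE _ _ _ MNS).
under eq_bigr do rewrite (mulE _ _ _ NS) nmul_sumr.
under [RHS]eq_bigr do rewrite (mulE _ _ _ MS) nmul_suml.
by rewrite exchange_big; do 2!apply: eq_bigr => ? _; rewrite nmulA.
Qed.

Fact fmat_mulDl : left_distributive fmat_mul +%R.
Proof.
move=> M N P; have [S SE] := common M N (M + N).
have MS i j : (i \notin S) || (j \notin S) -> entry M i j = 0 by case/SE.
have NS i j : (i \notin S) || (j \notin S) -> entry N i j = 0 by case/SE.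
have DS i j : (i \notin S) || (j \notin S) -> entry (M + N) i j = 0 by case/SE.
apply: FMat_eq => i j; rewrite (mulE _ _ _ DS).
transitivity (entry (fmat_mul M P) i j + entry (fmat_mul N P) i j) => //.
rewrite (mulE _ _ _ MS) (mulE _ _ _ NS) -big_split.
by apply: eq_bigr => l _; exact: nmulDl.
Qed.

Fact fmat_mulDr : right_distributive fmat_mul +%R.
Proof.
move=> M N P; have [S MS] := rows_cols M.
apply: FMat_eq => i j; rewrite (mulE _ _ _ MS).
transitivity (entry (fmat_mul M N) i j + entry (fmat_mul M P) i j) => //.
rewrite !(mulE _ _ _ MS) -big_split.
by apply: eq_bigr => l _; exact: nmulDr.
Qed.

Fact fmat_mulZl (c : k) M N : fmat_mul (c *: M) N = c *: fmat_mul M N.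
Proof.
have [S SE] := common M (c *: M) M.
have MS i j : (i \notin S) || (j \notin S) -> entry M i j = 0 by case/SE.
have cS i j : (i \notin S) || (j \notin S) -> entry (c *: M) i j = 0 by case/SE.
apply: FMat_eq => i j; rewrite (mulE _ _ _ cS).
transitivity (c *: entry (fmat_mul M N) i j) => //.
rewrite (mulE _ _ _ MS) scaler_sumr.
by apply: eq_bigr => l _; exact: nmulZl.
Qed.

Fact fmat_mulZr (c : k) M N : fmat_mul M (c *: N) = c *: fmat_mul M N.
Proof.
have [S MS] := rows_cols M.
apply: FMat_eq => i j; rewrite (mulE _ _ _ MS).
transitivity (c *: entry (fmat_mul M N) i j) => //.
rewrite (mulE _ _ _ MS) scaler_sumr.
by apply: eq_bigr => l _; exact: nmulZr.
Qed.

HB.instance Definition _ := Lmodule_isNUAlgebra.Build k FMat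
  fmat_mulA fmat_mulDl fmat_mulDr fmat_mulZl fmat_mulZr.

End FMat.

Section Gradings.
Variables (k : comPzRingType).

(* M is the internal direct sum of the submodules V i, for i in D. *)
Definition direct_sum (M : lmodType k) (I : choiceType) (D : set I)
    (V : I -> set M) : Prop :=
  (forall i, D i -> is_submodule (V i)) /\
  (forall x : M, exists! c : finsupp I M,
     [/\ forall i, D i -> V i (c i), forall i, ~ D i -> c i = 0
       & x = \sum_(i \in D) c i]).

Definition orthogonal_local_units (A : nuAlgType k) (E : set A) : Prop :=
  [/\ forall e, E e -> nmul e e = e,
      forall e f, E e -> E f -> e <> f -> nmul e f = 0,
      direct_sum E (fun e => [set nmul a e | a in [set: A]])
    & direct_sum E (fun e => [set nmul e a | a in [set: A]])].

Variables (G : groupType).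

Definition graded_algebra (A : nuAlgType k) (gA : G -> set A) : Prop :=
  direct_sum [set: G] gA /\
  forall s t, spanprod nmul (gA s) (gA t) `<=` gA (s * t)%g.

Definition partially_strongly_graded (A : nuAlgType k) (gA : G -> set A) :
    Prop :=
  graded_algebra gA /\
  forall t, gA t = spanprod nmul (spanprod nmul (gA t) (gA t^-1%g)) (gA t).

Definition Dideal (A : nuAlgType k) (gA : G -> set A) (t : G) : set A :=
  spanprod nmul (gA t) (gA t^-1%g).

Definition graded_bimodule (A B : nuAlgType k) (gA : G -> set A)
    (gB : G -> set B) (X : bimodType A B) (gX : G -> set X) : Prop :=
  [/\ direct_sum [set: G] gX,
      forall s t, spanprod lact (gA s) (gX t) `<=` gX (s * t)%g
    & forall s t, spanprod ract (gX s) (gB t) `<=` gX (s * t)%g].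

Definition unital_on (A B : nuAlgType k) (X : bimodType A B)
    (R : set A) (M : set X) (S : set B) : Prop :=
  spanprod lact R M = M /\ spanprod ract M S = M.

Definition is_bimodule_map (A : nuAlgType k) (M : bimodType A A) (f : M -> A) :
    Prop :=
  [/\ linear f, forall a m, f (lact a m) = nmul a (f m)
    & forall m a, f (ract m a) = nmul (f m) a].

Record morita_context (A B : nuAlgType k) := MoritaContext {
  mX : bimodType A B;
  mY : bimodType B A;
  tauA : tensor mX mY -> A;
  tauB : tensor mY mX -> B;
  tauA_map : is_bimodule_map tauA;
  tauB_map : is_bimodule_map tauB;
  tau_compatX : forall x y x',
    lact (tauA (tens x y)) x' = ract x (tauB (tens y x'));
  tau_compatY : forall y x y',
    lact (tauB (tens y x)) y' = ract y (tauA (tens x y'))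
}.

Section GradedMorita.
Variables (A B : nuAlgType k) (gA : G -> set A) (gB : G -> set B).
Variables (C : morita_context A B) (gX : G -> set (mX C)) (gY : G -> set (mY C)).

Definition graded_morita_context : Prop :=
  [/\ graded_bimodule gA gB gX, graded_bimodule gB gA gY,
      forall r s x y, gX r x -> gY s y -> gA (r * s)%g (tauA (tens x y))
    & forall r s y x, gY r y -> gX s x -> gB (r * s)%g (tauB (tens y x))].

Definition strong_morita_context : Prop :=
  forall t, unital_on (Dideal gA t) (gX t) (Dideal gB t^-1%g) /\
            unital_on (Dideal gB t) (gY t) (Dideal gA t^-1%g).

End GradedMorita.

(* The notion is only used for algebras A and B that are idempotent and whose
   ideals Dideal gA t, Dideal gB t are idempotent; partially strongly graded
   algebras have these properties. *)
Definition strongly_graded_equivalent (A B : nuAlgType k)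
    (gA : G -> set A) (gB : G -> set B) : Prop :=
  exists (C : morita_context A B) (gX : G -> set (mX C)) (gY : G -> set (mY C)),
    [/\ graded_morita_context gA gB gX gY, strong_morita_context gA gB gX gY,
        range (@tauA _ _ C) = [set: A] /\ range (@tauB _ _ C) = [set: B],
        forall t, spanprod (fun x y => tauA (tens x y)) (gX t) (gY t^-1%g)
                  = Dideal gA t
      & forall t, spanprod (fun y x => tauB (tens y x)) (gY t) (gX t^-1%g)
                  = Dideal gB t].

Definition FMat_grading (X : choiceType) (A : nuAlgType k) (gA : G -> set A)
    (g : G) : set (FMat X A) :=
  [set M | forall i j, gA g (entry M i j)].

Definition graded_isomorphism (A B : nuAlgType k)
    (gA : G -> set A) (gB : G -> set B) (phi : A -> B) : Prop :=
  [/\ linear phi, {morph phi : a b / nmul a b}, bijective phi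
    & forall g, phi @` gA g = gB g].

End Gradings.
Arguments FMat_grading {k G} X {A} gA g.

(* Main.v *)
From mathcomp Require Import all_boot all_algebra finmap.
From mathcomp Require Import boolp classical_sets functions cardinality fsbigop.
Require Import Defs.
Set Implicit Arguments.
Unset Strict Implicit.
Unset Printing Implicit Defensive.
Import GRing.Theory.
Local Open Scope classical_set_scope.
Local Open Scope card_scope.
Local Open Scope ring_scope.

(** Write X and Y for the bimodules of the given graded Morita context, xy and
yx for its two products, with values in A and in B, and L for the index set of
the matrices.

Why it is true: a matrix algebra with entries in A is an algebra of finite-rank
operators on a direct sum of copies of X, namely the span of the operators v |->
x (y v) with x a vector of entries in X and y a covector of entries in Y. In the
same way the matrices over B are the finite-rank operators on a direct sum of
copies of B. So it suffices to find a bijection between the sum of copies of X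
and that of copies of B which has an adjoint on the covectors and is homogeneous
of degree 1 on both sides: conjugation by it is the graded isomorphism. The
modules are kept together with their covectors because a matrix with finitely
many entries is finite in its rows and in its columns, and only adjointable maps
respect both.

The bijection comes from an Eilenberg swindle. If X is a summand of a sum of
copies of B, and B of a sum of copies of X, then the infinite sums absorb each
other (isometric_swindle), and absorption in both directions makes them
isometric (isometric_stable). This uses that an infinite index set is in
bijection with its square and with its product by nat (absorb_prod).

It remains to see the two summands, that is, to write the unit of A as a locally
finite sum of products x_i y_i with x_i, y_i of degree 1, and likewise for B
(ex_frame). The elements of E need not be homogeneous and need not lie in the
component A_1, so they cannot be factored directly. Their degree-1 components
p_e are no longer idempotent, but they still sum locally finitely to the unit,
since for a homogeneous a the element a p_e is one component of a e
(strict_unit_comp). Each p_e lies in A_1, which is spanned by products xy of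
degree 1. A factorization of p_e taken at random would not be locally finite,
because a p_e = 0 does not force a x = 0 for its factors x. The cure is to
insert q_e, the sum of the finitely many p_l for which p_l p_e or p_e p_l is
nonzero: q_e p_e q_e = p_e, and a q_e vanishes for almost all e, so the factors
q_e x and y q_e form locally finite families. *)

(** * Cardinal arithmetic of infinite sets *)

Definition injects (T U : Type) (A : set T) (B : set U) (f : T -> U) : Prop :=
  set_fun A B f /\ (forall x y, A x -> A y -> f x = f y -> x = y).

Lemma total_on_bigcup2 (T : Type) (F : set (set T)) p q : total_on F subset ->
  (\bigcup_(H in F) H) p -> (\bigcup_(H in F) H) q ->
  exists2 H, F H & H p /\ H q.
Proof.
move=> tF [H FH Hp] [H' FH' Hq].
have [HH'|H'H] := tF _ _ FH FH'.
  by exists H' => //; split=> //; exact: HH'.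
by exists H => //; split=> //; exact: H'H.
Qed.

(** A maximal partial injection exhausts one of the two sets, since a pair of
unmatched points would extend it. *)
Lemma injects_total (T : Type) (A B : set T) :
  (exists f, injects A B f) \/ (exists f, injects B A f).
Proof.
pose P (H : set (T * T)) := [/\ forall x y, H (x, y) -> A x /\ B y,
  forall x y y', H (x, y) -> H (x, y') -> y = y'
  & forall x x' y, H (x, y) -> H (x', y) -> x = x'].
have [F FP tF|H [[HAB Hfun Hinj] Hmax]] := @Zorn_bigcup _ P.
  split=> [x y [H /FP[HAB _ _] /HAB//]|x y y' h h'|x x' y h h'].
    by have [H /FP[_ Hf _] [/Hf]] := total_on_bigcup2 tF h h'; apply.
  by have [H /FP[_ _ Hi] [/Hi]] := total_on_bigcup2 tF h h'; apply.
have [domH|/existsNP[x /not_implyP[Ax xH]]] :=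
    pselect (forall x, A x -> exists y, H (x, y)).
  left; have [f fH] : {f & forall x, A x -> H (x, f x)}.
    apply: (choice (P := fun x y => A x -> H (x, y))) => x.
    have [/domH[y Hy]|nAx] := pselect (A x); last by exists x.
    by exists y.
  exists f; split=> [x /fH/HAB[]//|x y /fH Hx /fH Hy fxy].
  by apply: Hinj Hx _; rewrite fxy.
have [ranH|/existsNP[y /not_implyP[By yH]]] :=
    pselect (forall y, B y -> exists x, H (x, y)).
  right; have [f fH] : {f & forall y, B y -> H (f y, y)}.
    apply: (choice (P := fun y x => B y -> H (x, y))) => y.
    have [/ranH[x' Hx']|nAx] := pselect (B y); last by exists y.
    by exists x'.
  exists f; split=> [y /fH/HAB[]//|y y' /fH Hx /fH Hy fxy].
  by apply: Hfun Hx _; rewrite fxy.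
have xH' y' : ~ H (x, y') by move=> h; apply: xH; exists y'.
have yH' x' : ~ H (x', y) by move=> h; apply: yH; exists x'.
case: (Hmax (H `|` [set (x, y)])).
  by split=> [?|/(_ (x, y))]; [left|move=> h; apply: (xH' y); apply: h; right].
split=> [u v [/HAB//|[-> ->]//]|u v v'|u u' v].
- move=> [h|/pair_equal_spec[ux ->]] [h'|/pair_equal_spec[ux' ->]] //.
  + exact: Hfun h h'.
  + by rewrite ux' in h; case: (xH' _ h).
  + by rewrite ux in h'; case: (xH' _ h').
- move=> [h|/pair_equal_spec[-> vy]] [h'|/pair_equal_spec[-> vy']] //.
  + exact: Hinj h h'.
  + by rewrite vy' in h; case: (yH' _ h).
  + by rewrite vy in h'; case: (yH' _ h').
Qed.

Definition square_inj (T : Type) (S : set T) (f : T -> T -> T) : Prop :=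
  (forall x y, S x -> S y -> S (f x y)) /\
  (forall x y x' y', S x -> S y -> S x' -> S y' -> f x y = f x' y' ->
     x = x' /\ y = y').

(** The graph of an injection S * S -> S, with S recovered as the set of points
occurring on the diagonal. Partial functions are encoded as graphs so that a
chain of them has its union as upper bound. *)
Definition square_graph (T : Type) (H : set (T * T * T)) : Prop :=
  let S x := exists z, H (x, x, z) in
  [/\ forall x y z, H (x, y, z) -> [/\ S x, S y & S z],
      forall x y, S x -> S y -> exists z, H (x, y, z),
      forall x y z z', H (x, y, z) -> H (x, y, z') -> z = z'
    & forall x y x' y' z, H (x, y, z) -> H (x', y', z) -> x = x' /\ y = y'].

Lemma square_graph_of (T : Type) (S : set T) f : square_inj S f ->
  square_graph [set p | [/\ S p.1.1, S p.1.2 & p.2 = f p.1.1 p.1.2]].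
Proof.
move=> [fS finj]; split=> /=.
- move=> x y z [Sx Sy ->]; split; [by exists (f x x)|by exists (f y y)|].
  by exists (f (f x y) (f x y)); split=> //; exact: fS.
- by move=> x y [z [Sx _ _]] [z' [Sy _ _]]; exists (f x y).
- by move=> x y z z' [_ _ ->] [_ _ ->].
- by move=> x y x' y' z [Sx Sy ->] [Sx' Sy']; exact: finj.
Qed.

Lemma square_of_graph (T : Type) (H : set (T * T * T)) : square_graph H ->
  exists f, square_inj [set x | exists z, H (x, x, z)] f /\
    H = [set p | [/\ exists z, H (p.1.1, p.1.1, z),
                     exists z, H (p.1.2, p.1.2, z) & p.2 = f p.1.1 p.1.2]].
Proof.
move=> [Hdom Htot Hfun Hinj]; pose S x := exists z, H (x, x, z).
have [f fH] : {f : T * T -> T &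
    forall p, S p.1 -> S p.2 -> H (p.1, p.2, f p)}.
  apply: (choice (P := fun p z => S p.1 -> S p.2 -> H (p.1, p.2, z))) => p.
  have [S1|nS] := pselect (S p.1); last by exists p.1.
  have [S2|nS] := pselect (S p.2); last by exists p.1.
  by have [z Hz] := Htot _ _ S1 S2; exists z.
exists (fun x y => f (x, y)); split; first split.
- by move=> x y Sx Sy; have /Hdom[] := fH (x, y) Sx Sy.
- move=> x y x' y' Sx Sy Sx' Sy' E; apply: Hinj (fH (x, y) Sx Sy) _.
  by rewrite E; exact: (fH (x', y')).
- apply/seteqP; split=> [[[x y] z] Hxyz|[[x y] z] [/= Sx Sy ->]] /=.
    have [Sx Sy _] := Hdom _ _ _ Hxyz; split=> //.
    exact: Hfun Hxyz (fH (x, y) Sx Sy).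
  exact: (fH (x, y)).
Qed.

(** The extension step of the Hessenberg argument. If S contains its square, it
also contains the product of its square with pairs of bits, which is enough to
code the pairs of the doubled set by elements of S; the pairs that are not
already in S * S are sent to the new half. *)
Lemma square_inj_double (T : Type) (S : set T) f j c0 c1 :
  square_inj S f -> injects S (~` S) j -> S c0 -> S c1 -> c0 <> c1 ->
  exists f', square_inj (S `|` j @` S) f' /\
    (forall x y, S x -> S y -> f' x y = f x y).
Proof.
move=> [fS finj] [jS jinj] S0 S1 c01.
(* A bit is coded by c; i b s is the copy number b of s. *)
pose c (b : bool) := if b then c1 else c0.
pose i (b : bool) s := if b then j s else s.
have Sc b : S (c b) by case: b.
have cinj b b' : c b = c b' -> b = b' by case: b b' => -[] // /esym.
have iinj b s b' s' : S s -> S s' -> i b s = i b' s' -> b = b' /\ s = s'.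
  case: b b' => -[] //= Ss Ss' E; first by split=> //; exact: jinj.
    by have := jS _ Ss; rewrite E.
  by have := jS _ Ss'; rewrite -E.
pose code b b' s s' := if b || b' then f (f (c b) (c b')) (f s s') else f s s'.
have codeS b b' s s' : S s -> S s' -> S (code b b' s s').
  move=> Ss Ss'; rewrite /code; case: ifP => _; last exact: fS.
  exact: fS (fS _ _ (Sc b) (Sc b')) (fS _ _ Ss Ss').
have [dec decE] : {dec & forall x, (S `|` j @` S) x ->
    S (dec x).2 /\ x = i (dec x).1 (dec x).2}.
  apply: (choice (P := fun x (d : bool * T) => (S `|` j @` S) x ->
    S d.2 /\ x = i d.1 d.2)) => x.
  have [Sx|nSx] := pselect (S x); first by exists (false, x).
  have [[s Ss <-]|nx] := pselect ((j @` S) x); first by exists (true, s).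
  by exists (true, x) => -[].
have decS x : S x -> dec x = (false, x).
  move=> Sx; have [Sd /(iinj false _ _ _ Sx Sd)] := decE x (or_introl Sx).
  by case: (dec x) => ? ? /= [<- <-].
pose f' x y := i ((dec x).1 || (dec y).1)
  (code (dec x).1 (dec y).1 (dec x).2 (dec y).2).
exists f'; split; last by move=> x y Sx Sy; rewrite /f' !decS.
split=> [x y /decE[Sx _] /decE[Sy _]|x y x' y'].
  rewrite /f' /i; case: ifP => _; last by left; exact: codeS.
  by right; apply: imageP; exact: (codeS _ _ _ _ Sx Sy).
move=> /decE[Ss xE] /decE[Ss' yE] /decE[St xE'] /decE[St' yE'] H.
suff [E E'] : dec x = dec x' /\ dec y = dec y' by rewrite xE xE' yE yE' E E'.
move: Ss Ss' St St' H; rewrite /f' {xE yE xE' yE'}.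
case: (dec x) (dec y) (dec x') (dec y') => [b s] [b' s'] [d t] [d' t'] /=.
move=> Ss Ss' St St' /(iinj _ _ _ _ (codeS _ _ _ _ Ss Ss')
  (codeS _ _ _ _ St St'))[bd +]; rewrite /code -bd.
case: ifPn => [_|].
  case/(finj _ _ _ _ (fS _ _ (Sc b) (Sc b')) (fS _ _ Ss Ss')
      (fS _ _ (Sc d) (Sc d')) (fS _ _ St St')).
  case/(finj _ _ _ _ (Sc b) (Sc b') (Sc d) (Sc d')) => /cinj -> /cinj ->.
  by case/(finj _ _ _ _ Ss Ss' St St') => -> ->.
move=> nbb; move: bd; rewrite (negbTE nbb) => /esym/negbT; move: nbb.
rewrite !negb_or => /andP[/negPf -> /negPf ->] /andP[/negPf -> /negPf ->].
by case/(finj _ _ _ _ Ss Ss' St St') => -> ->.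
Qed.

Lemma nat_inj (T : Type) : infinite_set [set: T] ->
  exists e : nat -> T, injective e.
Proof.
move=> infT; have /infiniteP/card_leP[e] := infT.
exists (fun n => val (e (SigSub (mem_setT n)))) => m n /val_inj.
by move=> /(inj (mem_setT _) (mem_setT _))[].
Qed.

(** Take a maximal S with an injection S * S -> S. By maximality S cannot be
doubled inside T, so its complement embeds in S, hence T embeds in S, and the
injection carries over to T. *)
Lemma infinite_square_inj (T : Type) : infinite_set [set: T] ->
  exists f, square_inj [set: T] f.
Proof.
move=> infT.
have [e einj] := nat_inj infT.
have [g ginj] : exists g : nat * nat -> nat, injective g.
  by exists choice.pickle; exact: pcan_inj choice.pickleK.
pose S0 := range e.
have [d dE] : {d & forall x, S0 x -> x = e (d x)}.
  apply: (choice (P := fun x n => S0 x -> x = e n)) => x.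
  by have [[n _ <-]|nx] := pselect (S0 x); [exists n|exists 0].
pose f0 x y := e (g (d x, d y)).
have f0P : square_inj S0 f0.
  split=> [x y _ _|x y x' y' /dE {2}-> /dE {2}-> /dE {2}-> /dE {2}->].
    by exists (g (d x, d y)).
  by move=> /einj/ginj[-> ->].
have H0P := square_graph_of f0P; set H0 := [set p | _] in H0P.
have H0n0 : H0 (e 0%N, e 0%N, f0 (e 0%N) (e 0%N)) by split=> //; exists 0%N.
(* A finite S could be maximal (a point, for instance), so the graphs are
required to contain that of a countable S0; the empty graph is let in as the
upper bound of the empty chain. *)
pose P H := square_graph H /\ (H0 `<=` H \/ H = set0).
have [F FP tF|H [[Hsq HH0] Hmax]] := @Zorn_bigcup _ P.
  split; last first.
    have [[H FH H0H]|nH] := pselect (exists2 H, F H & H0 `<=` H).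
      by left=> p /H0H Hp; exists H.
    right; apply/seteqP; split=> // p [H FH Hp].
    have [_ [H0H|Hs]] := FP _ FH; first by case: nH; exists H.
    by rewrite Hs in Hp.
  split=> /=.
  - move=> x y z [H FH Hp]; have [[Hdom _ _ _] _] := FP _ FH.
    have [[z1 h1] [z2 h2] [z3 h3]] := Hdom _ _ _ Hp.
    by split; [exists z1|exists z2|exists z3]; exists H.
  - move=> x y [z h] [z' h']; have [H FH [Hx Hy]] := total_on_bigcup2 tF h h'.
    have [[_ Htot _ _] _] := FP _ FH.
    by have [||w Hw] := Htot x y; [exists z|exists z'|exists w; exists H].
  - move=> x y z z' h h'; have [H FH [Hx Hy]] := total_on_bigcup2 tF h h'.
    by have [[_ _ Hf _] _] := FP _ FH; exact: Hf Hx Hy.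
  - move=> x y x' y' z h h'; have [H FH [Hx Hy]] := total_on_bigcup2 tF h h'.
    by have [[_ _ _ Hi] _] := FP _ FH; exact: Hi Hx Hy.
have {}HH0 : H0 `<=` H.
  case: HH0 => // Hs; case: (Hmax H0); last by split=> //; left.
  by rewrite Hs; split=> // /(_ _ H0n0).
have [f [fP HE]] := square_of_graph Hsq; set S := [set x | _] in fP.
have S0S : S0 `<=` S.
  by move=> x S0x; exists (f0 x x); apply: HH0; split.
have [Se0 Se1] : S (e 0%N) /\ S (e 1%N) by split; apply: S0S; eexists.
have e01 : e 0%N <> e 1%N by move/einj.
have [fS finj] := fP.
have [[j jP]|[j [jS jinj]]] := injects_total S (~` S).
  have [f' [f'P f'f]] := square_inj_double fP jP Se0 Se1 e01.
  have H'P := square_graph_of f'P; set H' := [set p | _] in H'P.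
  have HH' : H `<=` H'.
    rewrite {1}HE => -[[x y] z] [/= Sx Sy ->].
    by split=> /=; [left|left|rewrite f'f].
  case: (Hmax H'); last by split=> //; left; exact: subset_trans HH'.
  split=> // H'H; have jSe0 : (S `|` j @` S) (j (e 0%N)) by right;
    exists (e 0%N).
  have /H'H : H' (j (e 0%N), j (e 0%N), f' (j (e 0%N)) (j (e 0%N))) by [].
  have [jS _] := jP; move=> h; apply: (jS (e 0%N)) => //.
  by eexists; exact: h.
(* The two halves S and its complement are told apart by a first coordinate. *)
pose c x := if pselect (S x) then f (e 0%N) x else f (e 1%N) (j x).
have cS x : S (c x).
  by rewrite /c; case: pselect => [Sx|nSx]; apply: fS => //; exact: jS.
have cinj x y : c x = c y -> x = y.
  rewrite /c; case: pselect => Sx; case: pselect => Sy.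
  - by case/finj.
  - by case/finj => //; exact: jS.
  - by case/finj => //; [exact: jS|move/esym].
  - by case/finj => //; [exact: jS|exact: jS|move=> _ /jinj; apply].
exists (fun x y => f (c x) (c y)); split=> // x y x' y' _ _ _ _ /finj[] //.
by move=> /cinj -> /cinj ->.
Qed.

Lemma inj_of_card_le (T U : Type) (A : set T) : A #<= [set: U] ->
  (exists x, A x) -> exists f : T -> U, forall x y, A x -> A y -> f x = f y ->
    x = y.
Proof.
move=> /card_leP[f] [a Aa].
pose d := SigSub (mem_set Aa) : A.
exists (fun x => val (f (insubd d x))) => x y Ax Ay /val_inj.
move=> /(inj (mem_setT _) (mem_setT _)) /(congr1 val).
by rewrite !insubdK //; exact: mem_set.
Qed.

Lemma card_le_of_inj (T U : Type) (f : T -> U) : injective f ->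
  [set: T] #<= [set: U].
Proof.
move=> finj; have [|g] := (@injfunPex _ _ [set: T] [set: U]).2.
  by exists f => // x y _ _; exact: finj.
exact: inj_card_le g.
Qed.

Lemma absorb_prod (X J : Type) (e : J -> X) (j0 : J) :
  infinite_set [set: X] -> injective e -> exists h : X * J -> X, bijective h.
Proof.
move=> infX einj; have [f [_ finj]] := infinite_square_inj infX.
have: [set: X * J] #= [set: X].
  rewrite card_eq_le; apply/andP; split.
    (* X * J embeds in X * X, hence in X. *)
    apply: (@card_le_of_inj _ _ (fun p => f p.1 (e p.2))).
    by move=> [x y] [x' y'] /finj[] // /= -> /einj ->.
  by apply: (@card_le_of_inj _ _ (fun x => (x, j0))) => x y [].
move=> /card_bijP[h [g hg gh]].
exists (fun p => val (h (SigSub (mem_setT p)))).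
exists (fun x => val (g (SigSub (mem_setT x)))) => x.
  have -> : SigSub (mem_setT (val (h (SigSub (mem_setT x))))) =
    h (SigSub (mem_setT x)) by exact/val_inj.
  by rewrite hg.
have -> : SigSub (mem_setT (val (g (SigSub (mem_setT x))))) =
  g (SigSub (mem_setT x)) by exact/val_inj.
by rewrite gh.
Qed.

(** * Linear maps, submodules and finite sums *)

Section Linear.
Variables (k : comPzRingType) (U V : lmodType k) (f : U -> V).
Hypothesis fl : linear f.

Lemma linD u v : f (u + v) = f u + f v.
Proof. by have := fl 1 u v; rewrite !scale1r. Qed.

Lemma lin0 : f 0 = 0.
Proof. by apply: (addrI (f 0)); rewrite -linD !addr0. Qed.

Lemma linZ c u : f (c *: u) = c *: f u.
Proof. by have := fl c u 0; rewrite lin0 !addr0. Qed.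

Lemma linN u : f (- u) = - f u.
Proof. by rewrite -scaleN1r linZ scaleN1r. Qed.

Lemma linB u v : f (u - v) = f u - f v.
Proof. by rewrite linD linN. Qed.

Lemma lin_sum (I : Type) (r : seq I) (F : I -> U) :
  f (\sum_(i <- r) F i) = \sum_(i <- r) f (F i).
Proof. exact: (big_morph f linD lin0). Qed.

End Linear.

Section Submodule.
Variables (k : comPzRingType) (M : lmodType k) (V : set M).
Hypothesis sV : is_submodule V.

Lemma submod0 : V 0. Proof. by case: sV. Qed.
Lemma submodD u v : V u -> V v -> V (u + v).
Proof. by move=> Vu Vv; rewrite -[u]scale1r; apply: sV.2. Qed.
Lemma submodZ c u : V u -> V (c *: u).
Proof. by move=> Vu; rewrite -[_ *: _]addr0; apply: sV.2 => //;
  exact: submod0. Qed.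
Lemma submodB u v : V u -> V v -> V (u - v).
Proof. by move=> Vu Vv; apply: submodD => //; rewrite -scaleN1r;
  exact: submodZ. Qed.
Lemma submod_sum (I : eqType) (r : seq I) (F : I -> M) :
  (forall i, i \in r -> V (F i)) -> V (\sum_(i <- r) F i).
Proof.
by move=> VF; rewrite big_seq; elim/big_ind: _ => //;
  [exact: submod0|exact: submodD].
Qed.

End Submodule.

Section FinFun.
Variables (k : comPzRingType) (I : choiceType).

Definition finfam (M : lmodType k) (F : I -> M) : Prop :=
  exists S : {fset I}, forall i, i \notin S -> F i = 0.

(** This is the library sum over the whole type; it is 0 when the support is
infinite, so every lemma below carries a finfam hypothesis where it matters. *)
Definition fsum (M : lmodType k) (F : I -> M) : M := \sum_(i \in [set: I]) F i.

Lemma fsumE (M : lmodType k) (F : I -> M) (S : {fset I}) :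
  (forall i, i \notin S -> F i = 0) -> fsum F = \sum_(i <- S) F i.
Proof. exact: fsbigTE. Qed.

Lemma finfam2 (M N : lmodType k) (F : I -> M) (G : I -> N) :
  finfam F -> finfam G -> exists S : {fset I},
    (forall i, i \notin S -> F i = 0) /\ (forall i, i \notin S -> G i = 0).
Proof.
move=> [S FS] [T GT]; exists (S `|` T)%fset.
by split=> i; rewrite inE negb_or => /andP[]; [move=> /FS|move=> _ /GT].
Qed.

Lemma finfam_comp (M N : lmodType k) (F : I -> M) (h : I -> M -> N) :
  (forall i, h i 0 = 0) -> finfam F -> finfam (fun i => h i (F i)).
Proof. by move=> h0 [S FS]; exists S => i /FS ->. Qed.

Lemma finfam_lin (M : lmodType k) (F G : I -> M) c :
  finfam F -> finfam G -> finfam (fun i => c *: F i + G i).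
Proof.
move=> hF hG; have [S [FS GS]] := finfam2 hF hG; exists S => i iS.
by rewrite FS // GS // scaler0 addr0.
Qed.

Lemma eq_fsum (M : lmodType k) (F G : I -> M) : F =1 G -> fsum F = fsum G.
Proof. by move=> /funext ->. Qed.

Lemma fsum_lin (M : lmodType k) (F G : I -> M) c : finfam F -> finfam G ->
  fsum (fun i => c *: F i + G i) = c *: fsum F + fsum G.
Proof.
move=> hF hG; have [S [FS GS]] := finfam2 hF hG.
rewrite (fsumE FS) (fsumE GS) (@fsumE _ _ S) => [|i iS].
  by rewrite scaler_sumr -big_split.
by rewrite FS // GS // scaler0 addr0.
Qed.

Lemma fsum_hom (M N : lmodType k) (h : M -> N) (F : I -> M) : linear h ->
  finfam F -> h (fsum F) = fsum (fun i => h (F i)).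
Proof.
move=> hl [S FS]; rewrite (fsumE FS) (@fsumE _ _ S) ?(lin_sum hl) // => i iS.
by rewrite FS // (lin0 hl).
Qed.

Lemma fsum0 (M : lmodType k) (F : I -> M) : (forall i, F i = 0) -> fsum F = 0.
Proof. by move=> F0; exact: fsbig1. Qed.

Lemma fsum1 (M : lmodType k) (F : I -> M) i0 :
  (forall i, i != i0 -> F i = 0) -> fsum F = F i0.
Proof.
move=> F0; rewrite (@fsumE _ _ [fset i0]%fset) ?big_seq_fset1 // => i.
by rewrite inE => /F0.
Qed.

Lemma fsum_submod (M : lmodType k) (V : set M) (F : I -> M) : is_submodule V ->
  finfam F -> (forall i, V (F i)) -> V (fsum F).
Proof. by move=> sV [S FS] VF; rewrite (fsumE FS); exact: submod_sum. Qed.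

(** Total, with junk value 0 on families of infinite support, so that maps
between modules of finitely supported functions can be written as plain
functions and their finiteness proved separately. *)
Definition finsupp_of (M : lmodType k) (F : I -> M) : finsupp I M :=
  if pselect (finsupp_pred F) is left h then FinSupp h else 0.

Lemma finfamP (M : lmodType k) (F : I -> M) : finfam F -> finsupp_pred F.
Proof.
move=> [S FS]; apply/asboolP; apply: (@sub_finite_set _ _ [set` S]) => //= i.
by apply: contra_neqT => /FS.
Qed.

Lemma finsupp_ofE (M : lmodType k) (F : I -> M) : finfam F ->
  fsval (finsupp_of F) = F.
Proof. by move=> /finfamP hF; rewrite /finsupp_of; case: pselect. Qed.

Lemma finfam_fs (M : lmodType k) (x : finsupp I M) : finfam x.
Proof. exact: finsupp_fset. Qed.

Lemma finsupp_eq (M : lmodType k) (x y : finsupp I M) : x =1 y -> x = y.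
Proof. by move=> xy; apply/val_inj/funext. Qed.

Lemma finsupp_linE (M : lmodType k) c (x y : finsupp I M) i :
  (c *: x + y) i = c *: x i + y i.
Proof. by []. Qed.

Definition single (M : lmodType k) (i : I) (m : M) : finsupp I M :=
  finsupp_of (fun j => if j == i then m else 0).

Lemma singleE (M : lmodType k) i (m : M) j :
  single i m j = if j == i then m else 0.
Proof.
rewrite /single finsupp_ofE //; exists [fset i]%fset => j'; rewrite inE.
by case: eqP.
Qed.

End FinFun.

Section Fubini.
Variables (k : comPzRingType) (M : lmodType k).

Lemma fsum_pair (I J : choiceType) (F : I -> J -> M) :
  finfam (fun p : I * J => F p.1 p.2) ->
  fsum (fun p : I * J => F p.1 p.2) = fsum (fun i => fsum (F i)).
Proof.
move=> [S FS]; pose A := [fset p.1 | p in S]%fset.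
pose B := [fset p.2 | p in S]%fset.
have AB i j : (i \notin A) || (j \notin B) -> F i j = 0.
  move=> ij; apply: (FS (i, j)); apply: contraL ij => ijS.
  by rewrite negb_or !negbK; apply/andP; split; apply/imfsetP; exists (i, j).
have Fi i : fsum (F i) = \sum_(j <- B) F i j.
  by apply: fsumE => j jB; rewrite AB // jB orbT.
rewrite [RHS](@fsumE _ _ _ _ A) => [|i iA]; last first.
  by apply: fsum0 => j; rewrite AB // iA.
have sq (K : choiceType) (C : {fset K}) (f : K -> M) :
  \sum_(i <- C) f i = \sum_(i \in [set` C]) f i by exact/fsbig_seq/fset_uniq.
rewrite (eq_bigr _ (fun i _ => Fi i)) sq.
under [RHS]eq_fsbigr do rewrite sq.
rewrite pair_fsbig //; apply/esym/fsbig_widen => // -[i j] [_ /= nij].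
by apply: AB; rewrite -negb_and; apply/negP => /andP.
Qed.

Lemma fsum_reindex (I J : choiceType) (h : I -> J) (F : J -> M) :
  bijective h -> fsum F = fsum (fun i => F (h i)).
Proof. by move=> hb; exact: reindex_fsbigT. Qed.

Lemma fsum_pairC (I J : choiceType) (F : J -> I -> M) :
  finfam (fun p : I * J => F p.2 p.1) ->
  fsum (fun p : I * J => F p.2 p.1) = fsum (fun j => fsum (F j)).
Proof.
move=> [S FS]; pose swap T U (p : T * U) := (p.2, p.1).
have swapK T U : cancel (@swap T U) (@swap U T) by case.
rewrite (@fsum_reindex _ _ (@swap J I)); last by exists (@swap I J).
apply: (fsum_pair (F := F)); exists [fset swap _ _ p | p in S]%fset => p pS.
apply: (FS (swap _ _ p)); apply: contraNN pS => pS.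
by apply/imfsetP; exists (swap _ _ p); rewrite ?swapK.
Qed.

End Fubini.

Lemma fsum_exchange (k : comPzRingType) (M : lmodType k) (I J : choiceType)
    (F : I -> J -> M) : finfam (fun p : I * J => F p.1 p.2) ->
  fsum (fun i => fsum (F i)) = fsum (fun j => fsum (fun i => F i j)).
Proof.
by move=> fF; rewrite -fsum_pair // (fsum_pairC (F := fun j i => F i j)).
Qed.

Section FinFun2.
Variables (k : comPzRingType).

Lemma finfam_inj (I J : choiceType) (M : lmodType k)
    (h : I -> J) g (F : J -> M) :
  cancel h g -> finfam F -> finfam (fun i => F (h i)).
Proof.
move=> hg [S FS]; exists [fset g j | j in S]%fset => i; apply: contraNeq => Fi.
apply/imfsetP; exists (h i); rewrite ?hg //=; apply: contraNT Fi => /FS ->.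
exact/eqP.
Qed.

Lemma fsum_nat (M : lmodType k) (F : nat -> M) N :
  (forall n, (N <= n)%N -> F n = 0) -> fsum F = \sum_(n <- iota 0 N) F n.
Proof.
move=> FN; rewrite (@bigfs _ _ _ _ (iota 0 N) predT) => [||n _].
- by apply: eq_fsbigl; apply/seteqP.
- exact: iota_uniq.
- by rewrite mem_iota add0n -leqNgt => /FN.
Qed.

Lemma finfam_nat (M : lmodType k) (F : nat -> M) :
  finfam F -> exists N, forall n, (N <= n)%N -> F n = 0.
Proof.
move=> [S FS]; exists (\max_(i <- S) i).+1 => n nN; apply: FS.
apply: contraL nN => nS; rewrite -ltnNge ltnS.
exact: (leq_bigmax_seq (F := id)) nS isT.
Qed.

Lemma fsum_natS (M : lmodType k) (F : nat -> M) : finfam F ->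
  fsum F = F 0%N + fsum (fun n => F n.+1).
Proof.
move=> /finfam_nat[N FN]; rewrite (@fsum_nat _ F N.+1) => [|n /ltnW/FN //].
rewrite (@fsum_nat _ (fun n => F n.+1) N) => [|n nN];
  last by rewrite FN // leqW.
by rewrite /= big_cons (iotaDl 1 0) big_map.
Qed.

Lemma finfam_bound (I J : choiceType) (M : lmodType k) (F : I -> J -> M)
  (S : {fset I}) : (forall i, finfam (F i)) ->
  exists T : {fset J}, forall i j, i \in S -> j \notin T -> F i j = 0.
Proof.
move=> hF; suff [T FT] : exists T : {fset J},
    forall i j, i \in enum_fset S -> j \notin T -> F i j = 0 by exists T.
elim: (enum_fset S) => [|i s [T IH]]; first by exists fset0.
have [T' FT'] := hF i; exists (T `|` T')%fset => i' j.
rewrite !inE negb_or => /orP[/eqP-> /andP[_ /FT']|i's /andP[jT _]] //.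
exact: IH.
Qed.

Lemma finfam_pair (I J : choiceType) (M : lmodType k) (F : J -> I -> M)
  (S : {fset J}) : (forall j, j \notin S -> forall i, F j i = 0) ->
  (forall j, finfam (F j)) -> finfam (fun p : I * J => F p.2 p.1).
Proof.
move=> FS fF; have [T FT] := finfam_bound S fF.
exists [fset ((i, j) : (I * J)%type) | i in T, j in S]%fset => -[i j] /= nij.
have [jS|/FS -> //] := boolP (j \in S); apply: FT => //.
apply: contraNN nij => iT; apply/imfset2P; exists i => //=; by exists j.
Qed.

End FinFun2.

Section Single.
Variables (k : comPzRingType) (I : choiceType) (M : lmodType k).

Lemma single_linear i : linear (@single k I M i).
Proof.
move=> c u v; apply: finsupp_eq => j; rewrite finsupp_linE !singleE.
by case: eqP => // _; rewrite scaler0 addr0.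
Qed.

Lemma finsupp_decomp (x : finsupp I M) : x = fsum (fun i => single i (x i)).
Proof.
have [S xS] := finfam_fs x.
have fS : finfam (fun i => single i (x i)).
  by exists S => i /xS ->; exact: lin0 (single_linear i).
apply: finsupp_eq => j; pose ev (y : finsupp I M) := y j.
rewrite -[RHS]/(ev _) (fsum_hom (h := ev)) // (fsum1 (i0 := j)).
  by rewrite /ev singleE eqxx.
by move=> i /negPf ij; rewrite /ev singleE eq_sym ij.
Qed.
End Single.

(** Turns a locally finite sum into a list, the form in which membership in a
span of products is stated. *)
Lemma fsum_seq (k : comPzRingType) (I : choiceType) (M N1 N2 : lmodType k)
    (th : N1 -> N2 -> M) (v : I -> N1) (w : I -> N2) (V : set N1) (W : set N2) :
  finfam (fun i => th (v i) (w i)) -> (forall i, V (v i)) ->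
    (forall i, W (w i)) ->
  exists2 s : seq (N1 * N2), forall p, p \in s -> V p.1 /\ W p.2
    & fsum (fun i => th (v i) (w i)) = \sum_(p <- s) th p.1 p.2.
Proof.
move=> [S FS] vV wW; exists [seq (v i, w i) | i <- S].
  by move=> p /mapP[i _ ->]; split; [exact: vV|exact: wW].
by rewrite (fsumE FS) big_map.
Qed.

(** * Dual pairs and the swindle *)

Section DualPairs.
Variables (k : comPzRingType) (Z : lmodType k).

(** A module of vectors with a module of covectors and a nondegenerate form with
values in Z. The submodule covec1 stands for the covectors of degree 1 (the unit
of the grading group): together with the form it determines the gradings that
matter, see vec_deg. *)
Record dpair := DPair {
  vec : lmodType k;
  covec : lmodType k;
  form : covec -> vec -> Z;
  covec1 : set covec;
  form_linl : forall v, linear (form^~ v);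
  form_linr : forall w, linear (form w);
  form_nondegr : forall v, (forall w, form w v = 0) -> v = 0;
  form_nondegl : forall w, (forall v, form w v = 0) -> w = 0;
  covec1_submod : is_submodule covec1
}.

(** Nondegeneracy makes such an f linear, and linear over all scalars that the
form respects. *)
Definition adjoint (P Q : dpair) (f : vec P -> vec Q)
    (f' : covec Q -> covec P) : Prop :=
  (forall w v, form w (f v) = form (f' w) v) /\
  (forall w, covec1 w -> covec1 (f' w)).

Lemma form_injr (P : dpair) (v v' : vec P) :
  (forall w, form w v = form w v') -> v = v'.
Proof.
move=> E; apply/eqP; rewrite -subr_eq0; apply/eqP/form_nondegr => w.
by rewrite (linB (form_linr w)) E subrr.
Qed.

Lemma form_injl (P : dpair) (w w' : covec P) :
  (forall v, form w v = form w' v) -> w = w'.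
Proof.
move=> E; apply/eqP; rewrite -subr_eq0; apply/eqP/form_nondegl => v.
by rewrite (linB (form_linl v)) E subrr.
Qed.

Section Adj.
Variables (P Q : dpair) (f : vec P -> vec Q) (f' : covec Q -> covec P).
Hypothesis ff' : adjoint f f'.

Lemma adjoint_linear : linear f.
Proof.
move=> c u v; apply: form_injr => w.
by rewrite ff'.1 (form_linr (f' w)) (form_linr w) !ff'.1.
Qed.

Lemma adjoint_linear' : linear f'.
Proof.
move=> c u w; apply: form_injl => v.
by rewrite -ff'.1 (form_linl (f v)) (form_linl v) -!ff'.1.
Qed.
End Adj.

Lemma adjoint_comp (P Q R : dpair) (f : vec P -> vec Q) f'
    (g : vec Q -> vec R) g' :
  adjoint f f' -> adjoint g g' ->
  adjoint (fun v => g (f v)) (fun w => f' (g' w)).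
Proof.
move=> [ff' fD] [gg' gD]; split=> [w v|w /gD/fD//].
by rewrite gg' ff'.
Qed.

Definition summand (P Q : dpair) : Prop :=
  exists (a : vec P -> vec Q) a' (b : vec Q -> vec P) b',
    [/\ adjoint a a', adjoint b b' & cancel a b].

Definition isometric (P Q : dpair) : Prop :=
  exists (a : vec P -> vec Q) a' (b : vec Q -> vec P) b',
    [/\ adjoint a a', adjoint b b', cancel a b & cancel b a].

(** An adjoint pair of bijections is an isometry: the inverses are automatically
adjoint to each other. This halves the work for curry and for the swindle. *)
Lemma isometric_of_unitary (P Q : dpair) (f : vec P -> vec Q) f' g g' :
  adjoint f f' ->
  cancel f g -> cancel g f -> cancel f' g' -> cancel g' f' ->
  (forall w, covec1 w -> covec1 (g' w)) -> isometric P Q.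
Proof.
move=> ff' fg gf fg' gf' gD; exists f, f', g, g'; split=> //; split=> // w v.
by rewrite -{1}[w]gf' -ff'.1 gf.
Qed.

Lemma adjoint_cancel (P Q : dpair) (f : vec P -> vec Q) f' g g' :
  adjoint f f' -> adjoint g g' -> cancel f g -> cancel g' f'.
Proof.
by move=> ff' gg' fg w; apply: form_injl => v; rewrite -ff'.1 -gg'.1 fg.
Qed.

Lemma isometric_sym (P Q : dpair) : isometric P Q -> isometric Q P.
Proof. by move=> [a [a' [b [b' []]]]]; exists b, b', a, a'. Qed.

Lemma isometric_trans (P Q R : dpair) : isometric P Q -> isometric Q R ->
  isometric P R.
Proof.
move=> [a [a' [b [b' [aa bb ab ba]]]]] [c [c' [d [d' [cc dd cd dc]]]]].
exists (c \o a), (a' \o c'), (b \o d), (d' \o b'); split.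
- exact: adjoint_comp.
- exact: adjoint_comp.
- by move=> v; rewrite /= cd ab.
- by move=> v; rewrite /= ba dc.
Qed.

Lemma summand_iso (P Q R : dpair) : summand P Q -> isometric Q R -> summand P R.
Proof.
move=> [a [a' [b [b' [aa bb ab]]]]] [c [c' [d [d' [cc dd cd dc]]]]].
exists (c \o a), (a' \o c'), (b \o d), (d' \o b'); split.
- exact: adjoint_comp.
- exact: adjoint_comp.
- by move=> v; rewrite /= cd ab.
Qed.

Section FsPair.
Variables (I : choiceType) (P : dpair).

Definition fs_pr (y : finsupp I (covec P)) (x : finsupp I (vec P)) : Z :=
  fsum (fun i => form (y i) (x i)).

Lemma form0l (R : dpair) (v : vec R) : form 0 v = 0.
Proof. exact: lin0 (form_linl v). Qed.
Lemma form0r (R : dpair) (w : covec R) : form w 0 = 0.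
Proof. exact: lin0 (form_linr w). Qed.

Lemma fs_pr_finl (y : finsupp I (covec P)) (x : I -> vec P) :
  finfam (fun i => form (y i) (x i)).
Proof. by have [S yS] := finfam_fs y; exists S => i /yS ->; exact: form0l. Qed.

Lemma fs_pr_finr (y : I -> covec P) (x : finsupp I (vec P)) :
  finfam (fun i => form (y i) (x i)).
Proof. by have [S xS] := finfam_fs x; exists S => i /xS ->; exact: form0r. Qed.

Lemma fs_pr_linl x : linear (fs_pr^~ x).
Proof.
move=> c y y'; rewrite /fs_pr -fsum_lin; try exact: fs_pr_finl.
by apply: eq_fsum => i; rewrite finsupp_linE (form_linl (x i)).
Qed.

Lemma fs_pr_linr y : linear (fs_pr y).
Proof.
move=> c x x'; rewrite /fs_pr -fsum_lin; try exact: fs_pr_finl.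
by apply: eq_fsum => i; rewrite finsupp_linE (form_linr (y i)).
Qed.

Lemma fs_pr_single_l i w x : fs_pr (single i w) x = form w (x i).
Proof.
rewrite /fs_pr (fsum1 (i0 := i)) ?singleE ?eqxx // => j /negPf ji.
by rewrite singleE ji form0l.
Qed.

Lemma fs_pr_single_r i y v : fs_pr y (single i v) = form (y i) v.
Proof.
rewrite /fs_pr (fsum1 (i0 := i)) ?singleE ?eqxx // => j /negPf ji.
by rewrite singleE ji form0r.
Qed.

Lemma fs_nondegr x : (forall y, fs_pr y x = 0) -> x = 0.
Proof.
move=> x0; apply: finsupp_eq => i; apply: form_nondegr => w.
by rewrite -fs_pr_single_l x0.
Qed.

Lemma fs_nondegl y : (forall x, fs_pr y x = 0) -> y = 0.
Proof.
move=> y0; apply: finsupp_eq => i; apply: form_nondegl => v.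
by rewrite -fs_pr_single_r y0.
Qed.

Definition fs_covec1 : set (finsupp I (covec P)) :=
  [set y | forall i, covec1 (y i)].

Lemma fs_covec1_submod : is_submodule fs_covec1.
Proof.
split=> [i|c y y' yD y'D i]; first exact: submod0 (covec1_submod P).
by apply: (covec1_submod P).2; [exact: yD|exact: y'D].
Qed.

Definition fs_pair : dpair :=
  DPair fs_pr_linl fs_pr_linr fs_nondegr fs_nondegl fs_covec1_submod.

End FsPair.

Definition fs_map (I : choiceType) (M N : lmodType k) (f : M -> N)
  (x : finsupp I M) : finsupp I N := finsupp_of (fun i => f (x i)).

Lemma fs_mapE (I : choiceType) (M N : lmodType k) (f : M -> N)
  (x : finsupp I M) i : linear f -> fs_map f x i = f (x i).
Proof.
move=> fl; rewrite /fs_map finsupp_ofE //; have [S xS] := finfam_fs x.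
by exists S => j /xS ->; exact: lin0.
Qed.

Lemma adjoint_amp (I : choiceType) (P Q : dpair) (f : vec P -> vec Q) f' :
  adjoint f f' ->
  @adjoint (fs_pair I P) (fs_pair I Q) (fs_map f) (fs_map f').
Proof.
move=> ff'; have fl := adjoint_linear ff'; have fl' := adjoint_linear' ff'.
split=> [w v|w wD i]; last by rewrite fs_mapE //; exact/ff'.2/wD.
by apply: eq_fsum => i; rewrite !fs_mapE // ff'.1.
Qed.

Lemma summand_amp (I : choiceType) (P Q : dpair) : summand P Q ->
  summand (fs_pair I P) (fs_pair I Q).
Proof.
move=> [a [a' [b [b' [aa bb ab]]]]].
exists (fs_map a), (fs_map a'), (fs_map b), (fs_map b').
split; try exact: adjoint_amp.
have [al bl] := (adjoint_linear aa, adjoint_linear bb).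
by move=> v; apply: finsupp_eq => i; rewrite !fs_mapE ?ab.
Qed.

Section Curry.
Variables (I J L : choiceType) (h : I * J -> L) (g : L -> I * J).
Hypotheses (hg : cancel h g) (gh : cancel g h).

Definition curry_fs (M : lmodType k) (x : finsupp L M) :
    finsupp J (finsupp I M) :=
  finsupp_of (fun j => finsupp_of (fun i => x (h (i, j)))).

Definition uncurry_fs (M : lmodType k) (x : finsupp J (finsupp I M)) :
    finsupp L M :=
  finsupp_of (fun l => x (g l).2 (g l).1).

Lemma curry_fsE (M : lmodType k) (x : finsupp L M) i j :
  curry_fs x j i = x (h (i, j)).
Proof.
have fi j' : finfam (fun i => x (h (i, j'))).
  apply: (@finfam_inj _ _ _ _ (fun i => h (i, j')) (fun l => (g l).1)).
    by move=> i'; rewrite hg.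
  exact: finfam_fs.
rewrite /curry_fs finsupp_ofE ?finsupp_ofE //; have [S xS] := finfam_fs x.
exists [fset (g l).2 | l in S]%fset => j' j'S; apply: finsupp_eq => i'.
rewrite finsupp_ofE //; apply: xS; apply: contraNN j'S => hS.
by apply/imfsetP; exists (h (i', j')); rewrite // hg.
Qed.

Lemma uncurry_fsE (M : lmodType k) (x : finsupp J (finsupp I M)) l :
  uncurry_fs x l = x (g l).2 (g l).1.
Proof.
rewrite /uncurry_fs finsupp_ofE //; have [S xS] := finfam_fs x.
apply: (finfam_inj gh (F := fun p => x p.2 p.1)).
apply: (finfam_pair (F := fun j i => x j i) (S := S)) => [j /xS -> //|j].
exact: finfam_fs.
Qed.

Lemma curryK (M : lmodType k) : cancel (@curry_fs M) (@uncurry_fs M).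
Proof.
by move=> x; apply: finsupp_eq => l;
  rewrite uncurry_fsE curry_fsE -surjective_pairing gh.
Qed.

Lemma uncurryK (M : lmodType k) : cancel (@uncurry_fs M) (@curry_fs M).
Proof.
move=> x; apply: finsupp_eq => j; apply: finsupp_eq => i.
by rewrite curry_fsE uncurry_fsE hg.
Qed.

(** A direct sum over L = I * J is a J-indexed sum of I-indexed sums. With L = I
it says that an infinite direct sum absorbs repetition. *)
Lemma isometric_curry (P : dpair) :
  isometric (fs_pair L P) (fs_pair J (fs_pair I P)).
Proof.
apply: (@isometric_of_unitary (fs_pair L P) (fs_pair J (fs_pair I P))
  (@curry_fs _) (@uncurry_fs _) (@uncurry_fs _) (@curry_fs _)).
- split=> [w v|w wD l]; last by rewrite uncurry_fsE; exact: wD.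
  rewrite /= /fs_pr [RHS](fsum_reindex (h := h)); last by exists g.
  pose F j i := form (uncurry_fs w (h (i, j))) (v (h (i, j))).
  rewrite (@eq_fsum _ _ _ _ (fun p => F p.2 p.1)) => [|[] //].
  rewrite fsum_pairC.
    apply: eq_fsum => j; apply: eq_fsum => i.
    by rewrite /F uncurry_fsE curry_fsE hg.
  have := @finfam_inj _ _ _ _ h g _ hg (fs_pr_finr (uncurry_fs w) v).
  by case=> S FS; exists S => -[i j] /FS.
- exact: curryK.
- exact: uncurryK.
- exact: uncurryK.
- exact: curryK.
- by move=> w wD j i; rewrite curry_fsE; exact: wD.
Qed.
End Curry.

Section ProdPair.
Variables (P Q : dpair).
Definition prod_pr (w : covec P * covec Q) (v : vec P * vec Q) : Z :=
  form w.1 v.1 + form w.2 v.2.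

Lemma prod_linl v : linear (prod_pr^~ v).
Proof.
move=> c w w'; rewrite /prod_pr /= (form_linl v.1) (form_linl v.2).
by rewrite scalerDr addrACA.
Qed.
Lemma prod_linr w : linear (prod_pr w).
Proof.
move=> c v v'; rewrite /prod_pr /= (form_linr w.1) (form_linr w.2).
by rewrite scalerDr addrACA.
Qed.
Lemma prod_nondegr v : (forall w, prod_pr w v = 0) -> v = 0.
Proof.
case: v => v1 v2 v0; congr (_, _); apply: form_nondegr => w.
  by have := v0 (w, 0); rewrite /prod_pr /= form0l addr0.
by have := v0 (0, w); rewrite /prod_pr /= form0l add0r.
Qed.
Lemma prod_nondegl w : (forall v, prod_pr w v = 0) -> w = 0.
Proof.
case: w => w1 w2 w0; congr (_, _); apply: form_nondegl => v.
  by have := w0 (v, 0); rewrite /prod_pr /= form0r addr0.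
by have := w0 (0, v); rewrite /prod_pr /= form0r add0r.
Qed.
Definition prod_covec1 : set (covec P * covec Q) :=
  [set w | covec1 w.1 /\ covec1 w.2].
Lemma prod_covec1_submod : is_submodule prod_covec1.
Proof.
split=> [|c w w' [w1 w2] [w1' w2']].
  by split; [exact: submod0 (covec1_submod P)|exact: submod0 (covec1_submod Q)].
by split; [exact: (covec1_submod P).2|exact: (covec1_submod Q).2].
Qed.
Definition prod_pair : dpair :=
  DPair prod_linl prod_linr prod_nondegr prod_nondegl prod_covec1_submod.
End ProdPair.

Lemma isometric_prodC (P Q : dpair) : isometric (prod_pair P Q) (prod_pair Q P).
Proof.
exists (fun v => (v.2, v.1)), (fun w => (w.2, w.1)).
exists (fun v => (v.2, v.1)), (fun w => (w.2, w.1)).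
split=> [||[]|[]] //; split=> [w v|w []//]; by rewrite /= /prod_pr addrC.
Qed.

Lemma isometric_prodr (P Q R : dpair) : isometric Q R ->
  isometric (prod_pair P Q) (prod_pair P R).
Proof.
move=> [a [a' [b [b' [[aa aD] [bb bD] ab ba]]]]].
exists (fun v => (v.1, a v.2)), (fun w => (w.1, a' w.2)).
exists (fun v => (v.1, b v.2)), (fun w => (w.1, b' w.2)).
split=> [||[v1 v2]|[v1 v2]] /=; rewrite ?ab ?ba //.
  by split=> [w v|w [w1 /aD]//]; rewrite /= /prod_pr aa.
by split=> [w v|w [w1 /bD]//]; rewrite /= /prod_pr bb.
Qed.

(** Here e = a b is the idempotent of N with image a copy of M, so that
informally N = M + N' with e the projection on M. In the sequence of copies of
N, the map swindle_split takes the M part out of copy 0 and moves the M part of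
copy n + 1 down to copy n, while the N' parts stay; swindle_join is the way
back. *)
Section Swindle.
Variables (M N : lmodType k) (a : M -> N) (b : N -> M).
Hypotheses (al : linear a) (bl : linear b) (ab : cancel a b).
Let e v := a (b v).

Definition swindle_split (x : finsupp nat N) : M * finsupp nat N :=
  (b (x 0%N), finsupp_of (fun n => e (x n.+1) + (x n - e (x n)))).
Definition swindle_join (z : M * finsupp nat N) : finsupp nat N :=
  finsupp_of (fun n => (if n is m.+1 then e (z.2 m) else a z.1) +
    (z.2 n - e (z.2 n))).

Let el : linear e. Proof. by move=> c u v; rewrite /e bl al. Qed.
Let e0 : e 0 = 0. Proof. exact: lin0 el. Qed.
Let ee v : e (e v) = e v. Proof. by rewrite /e ab. Qed.
Let ea v : e (a v) = a v. Proof. by rewrite /e ab. Qed.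

Lemma swindle_splitE x n : (swindle_split x).2 n = e (x n.+1) + (x n - e (x n)).
Proof.
rewrite /swindle_split /= finsupp_ofE //; have [K xK] :=
  finfam_nat (finfam_fs x).
exists (seq_fset tt (iota 0 K)) => m; rewrite seq_fsetE mem_iota -leqNgt => Km.
by rewrite !xK ?e0 ?subr0 ?addr0 // leqW.
Qed.

Lemma swindle_joinE z n : swindle_join z n =
  (if n is m.+1 then e (z.2 m) else a z.1) + (z.2 n - e (z.2 n)).
Proof.
rewrite /swindle_join finsupp_ofE //; have [K xK] := finfam_nat (finfam_fs z.2).
exists (seq_fset tt (iota 0 K.+1)) => -[|m];
  rewrite seq_fsetE mem_iota //= -leqNgt.
by rewrite add0n => Km; rewrite !xK ?e0 ?subr0 ?addr0 // leqW.
Qed.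

Lemma swindle_splitK : cancel swindle_split swindle_join.
Proof.
move=> x; apply: finsupp_eq => n; rewrite swindle_joinE.
have eR v w : e (e v + (w - e w)) = e v.
  by rewrite (linD el) (linB el) !ee subrr addr0.
case: n => [|n]; rewrite !swindle_splitE !eR.
  by rewrite [e (x 1%N) + _]addrC addrK /= -/(e _) addrCA subrr addr0.
by rewrite [e (x n.+2) + _]addrC addrK addrCA subrr addr0.
Qed.

Lemma swindle_joinK : cancel swindle_join swindle_split.
Proof.
move=> z; have eR (c w : N) : e c = c -> e (c + (w - e w)) = c.
  by move=> ec; rewrite (linD el) (linB el) !ee subrr addr0.
rewrite [LHS]surjective_pairing [RHS]surjective_pairing; congr (_, _).
  rewrite /= swindle_joinE (linD bl) (linB bl) ab /e ab subrr addr0.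
  by [].
apply: finsupp_eq => n; rewrite swindle_splitE !swindle_joinE !eR ?ee //.
  by rewrite [X in _ + X]addrC addKr addrCA subrr addr0.
by case: n => // ; rewrite ee.
Qed.
End Swindle.

(** The adjoint of the splitting map is a joining map, for the covectors, where
the roles of a and b are taken by the adjoints b' and a'. So both directions are
inverted by the same two lemmas. *)
Lemma isometric_swindle (P Q : dpair) : summand P Q ->
  isometric (fs_pair nat Q) (prod_pair P (fs_pair nat Q)).
Proof.
move=> [a [a' [b [b' [aa bb ab]]]]].
have [al al'] := (adjoint_linear aa, adjoint_linear' aa).
have [bl bl'] := (adjoint_linear bb, adjoint_linear' bb).
have ab' := adjoint_cancel aa bb ab.
have eadj w v : form w (a (b v)) = form (b' (a' w)) v by rewrite aa.1 bb.1.
apply: (@isometric_of_unitary (fs_pair nat Q) (prod_pair P (fs_pair nat Q))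
  (swindle_split a b) (swindle_join b' a') (swindle_join a b)
    (swindle_split b' a')).
- split=> [w v|w [w1D w2D] n]; last first.
    rewrite swindle_joinE //; apply: submodD; first exact: covec1_submod.
      by case: n => [|n]; [exact/bb.2|exact/bb.2/aa.2/w2D].
    by apply: submodB; [exact: covec1_submod|exact: w2D|exact/bb.2/aa.2/w2D].
  rewrite /= /prod_pr /= /fs_pr.
  pose c n := if n is m.+1 then b' (a' (w.2 m)) else b' w.1.
  transitivity (fsum (fun n => form (c n) (v n)) +
      fsum (fun n => form (w.2 n - b' (a' (w.2 n))) (v n))); last first.
    rewrite -[X in X + _]scale1r -fsum_lin; try exact: fs_pr_finr.
    apply: eq_fsum => n; rewrite scale1r swindle_joinE //.
    by rewrite [RHS](linD (form_linl (v n))).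
  (* The shift by one copy is adjoint to the opposite shift. *)
  rewrite fsum_natS; last exact: fs_pr_finr.
  rewrite /= -bb.1 -addrA; congr (_ + _).
  rewrite -[X in X + _]scale1r -fsum_lin.
  + apply: eq_fsum => n;
    rewrite scale1r -[finsupp_of _]/((swindle_split a b v).2) swindle_splitE //.
    rewrite (linD (form_linr _)) (linB (form_linr _)) (linB (form_linl _)).
    by rewrite !eadj.
  + exact: (@finfam_inj _ _ _ _ succn predn (fun n => form (c n) (v n)))
    (fs_pr_finr _ _).
  + exact: fs_pr_finr.
- exact: swindle_splitK.
- exact: swindle_joinK.
- exact: swindle_joinK.
- exact: swindle_splitK.
- move=> w wD; split=> [|n]; first exact/aa.2/wD.
  rewrite swindle_splitE //; apply: submodD; first exact: covec1_submod.
    exact/bb.2/aa.2/wD.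
  by apply: submodB; [exact: covec1_submod|exact: wD|exact/bb.2/aa.2/wD].
Qed.

Lemma isometric_absorb (P Q : dpair) : isometric (fs_pair nat Q) Q ->
  summand P Q ->
  isometric Q (prod_pair P Q).
Proof.
move=> QQ /isometric_swindle PQ; apply: isometric_trans (isometric_sym QQ) _.
apply: isometric_trans PQ _; exact: isometric_prodr.
Qed.

(** Mutual summands need not be isometric in general; when both absorb countable
repetition, each absorbs the other: P = Q + P = P + Q = Q. *)
Lemma isometric_schroeder_bernstein (P Q : dpair) :
  isometric (fs_pair nat P) P -> isometric (fs_pair nat Q) Q ->
  summand P Q -> summand Q P -> isometric P Q.
Proof.
move=> PP QQ PQ QP; apply: isometric_trans (isometric_absorb PP QP) _.
by apply: isometric_trans (isometric_prodC _ _) _;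
  exact/isometric_sym/isometric_absorb.
Qed.

(** Summands of sums of copies of each other become isometric after taking the
sum over an infinite L, since a sum of L-fold sums is an L-fold sum. *)
Lemma isometric_stable (L : choiceType) (h : L * L -> L) (h' : L * nat -> L)
  (P Q : dpair) : bijective h -> bijective h' ->
  summand P (fs_pair L Q) -> summand Q (fs_pair L P) ->
  isometric (fs_pair L P) (fs_pair L Q).
Proof.
move=> [g hg gh] [g' hg' gh'] PQ QP; apply: isometric_schroeder_bernstein.
- exact/isometric_sym/(isometric_curry hg' gh').
- exact/isometric_sym/(isometric_curry hg' gh').
- exact: summand_iso (summand_amp L PQ)
  (isometric_sym (isometric_curry hg gh Q)).
- exact: summand_iso (summand_amp L QP)
  (isometric_sym (isometric_curry hg gh P)).
Qed.

End DualPairs.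

(** * Locally finite partitions of unity in degree one *)

Section Bilinear.
Variables (k : comPzRingType) (A B : nuAlgType k) (X : bimodType A B).

Lemma nmul_linl (b : A) : linear (nmul^~ b).
Proof. by move=> c u v; rewrite nmulDl nmulZl. Qed.
Lemma nmul_linr (a : A) : linear (nmul a).
Proof. by move=> c u v; rewrite nmulDr nmulZr. Qed.
Lemma lact_linl (x : X) : linear (lact^~ x).
Proof. by move=> c u v; rewrite lactDl lactZl. Qed.
Lemma lact_linr (a : A) : linear (@lact _ _ _ X a).
Proof. by move=> c u v; rewrite lactDr lactZr. Qed.
Lemma ract_linl (b : B) : linear ((@ract _ _ _ X)^~ b).
Proof. by move=> c u v; rewrite ractDl ractZl. Qed.
Lemma ract_linr (x : X) : linear (ract x).
Proof. by move=> c u v; rewrite ractDr ractZr. Qed.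
End Bilinear.

Lemma spanprod_sum (k : comPzRingType) (M N P : lmodType k) (op : M -> N -> P)
    (U : set M) (V : set N) z :
  (forall n, linear (op^~ n)) -> is_submodule U -> spanprod op U V z ->
  exists2 s : seq (M * N), forall p, p \in s -> U p.1 /\ V p.2
    & z = \sum_(p <- s) op p.1 p.2.
Proof.
move=> opl sU; pose W := [set z | exists2 s : seq (M * N),
  forall p, p \in s -> U p.1 /\ V p.2 & z = \sum_(p <- s) op p.1 p.2].
apply: (@span_min _ _ _ W) => [|_ [u Uu [v Vv <-]]]; last first.
  exists [:: (u, v)]; last by rewrite big_seq1.
  by move=> p; rewrite inE => /eqP->.
split; first by exists [::]; rewrite // big_nil.
move=> c _ _ [s sUV ->] [r rUV ->].
exists ([seq (c *: p.1, p.2) | p <- s] ++ r).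
  move=> p; rewrite mem_cat => /orP[/mapP[q /sUV[q1 q2] ->]|/rUV//].
  by split=> //; exact: submodZ.
rewrite big_cat big_map scaler_sumr; congr (_ + _); apply: eq_bigr => p _ /=.
by rewrite (linZ (opl _)).
Qed.

Section Components.
Variables (k : comPzRingType) (G : choiceType) (M : lmodType k).
Variable gM : G -> set M.
Hypothesis dM : direct_sum [set: G] gM.

Lemma component_submod g : is_submodule (gM g). Proof. exact: dM.1. Qed.

Lemma comp_ex x : exists c : finsupp G M, (forall g, gM g (c g)) /\ x = fsum c.
Proof.
by have [c [[cg _ xE] _]] := dM.2 x; exists c; split=> // g; exact: cg.
Qed.

Definition comp (x : M) : finsupp G M := projT1 (cid (comp_ex x)).

Lemma comp_in x g : gM g (comp x g).
Proof. by rewrite /comp; case: cid => c []. Qed.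

Lemma comp_sum x : x = fsum (comp x).
Proof. by rewrite /comp; case: cid => c []. Qed.

Lemma comp_uniq x (c : G -> M) : finfam c -> (forall g, gM g (c g)) ->
  x = fsum c -> comp x =1 c.
Proof.
move=> cf cg xE; have [d [_ du]] := dM.2 x.
have -> : comp x = d.
  apply/esym/du; split=> [g _|g []//|]; first exact: comp_in.
  exact: comp_sum.
have -> : d = finsupp_of c; last by move=> g; rewrite finsupp_ofE.
by apply: du; rewrite finsupp_ofE //; split=> // g [].
Qed.

Lemma comp_linear g : linear (fun x => comp x g).
Proof.
move=> c x y; rewrite (@comp_uniq _ (fun g => c *: comp x g + comp y g)) //.
- by apply: finfam_lin; exact: finfam_fs.
- by move=> h; apply: (component_submod h).2; exact: comp_in.
- by rewrite fsum_lin -?comp_sum //; exact: finfam_fs.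
Qed.

Lemma comp_homog x g : gM g x -> comp x g = x.
Proof.
move=> xg; rewrite (@comp_uniq _ (fun h => if h == g then x else 0)) ?eqxx //.
- by exists [fset g]%fset => h; rewrite inE => /negPf ->.
- by move=> h; case: eqP => [->//|_]; exact: submod0 (component_submod h).
- by rewrite (fsum1 (i0 := g)) ?eqxx // => h /negPf ->.
Qed.

Lemma homog_ind (V : set M) : is_submodule V ->
  (forall g x, gM g x -> V x) -> forall x, V x.
Proof.
move=> sV gV x; rewrite (comp_sum x); apply: fsum_submod => //.
  exact: finfam_fs.
by move=> g; apply: gV (comp_in x g).
Qed.
End Components.

Section GradedAlg.
Variables (k : comPzRingType) (G : groupType) (A : nuAlgType k).
Variable gA : G -> set A.
Hypothesis grA : graded_algebra gA.

Lemma graded_mul s t a b : gA s a -> gA t b -> gA (s * t)%g (nmul a b).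
Proof. by move=> sa tb; apply: grA.2; apply: sub_span; exists a => //;
  exists b. Qed.

(** Multiplication by a homogeneous element shifts components, because the
shifted family is a homogeneous decomposition of the product. *)
Lemma comp_mull s a x g : gA s a ->
  comp grA.1 (nmul a x) (s * g)%g = nmul a (comp grA.1 x g).
Proof.
move=> sa; pose c h := nmul a (comp grA.1 x (s^-1 * h)%g).
have cE : comp grA.1 (nmul a x) =1 c.
  apply: comp_uniq; rewrite /c.
  - apply: (@finfam_inj _ _ _ _ (fun h => s^-1 * h)%g (fun h => s * h)%g
      (fun h => nmul a (comp grA.1 x h))).
      by move=> h; rewrite mulgA mulgV mul1g.
    have [S xS] := finfam_fs (comp grA.1 x); exists S => h /xS ->.
    exact: lin0 (nmul_linr a).
  - move=> h; rewrite -{1}[h]mul1g -(mulgV s) -mulgA.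
    exact: graded_mul sa (comp_in _ _ _).
  - rewrite {1}(comp_sum grA.1 x) (fsum_hom (nmul_linr a));
    last exact: finfam_fs.
    apply: (@fsum_reindex _ _ _ _ (fun h => s^-1 * h)%g).
    by exists (fun h => s * h)%g => h; rewrite mulgA ?mulVg ?mulgV mul1g.
by rewrite cE /c mulgA mulVg mul1g.
Qed.

Lemma comp_mulr s a x g : gA s a ->
  comp grA.1 (nmul x a) (g * s)%g = nmul (comp grA.1 x g) a.
Proof.
move=> sa; pose c h := nmul (comp grA.1 x (h * s^-1)%g) a.
have cE : comp grA.1 (nmul x a) =1 c.
  apply: comp_uniq; rewrite /c.
  - apply: (@finfam_inj _ _ _ _ (fun h => h * s^-1)%g (fun h => h * s)%g
      (fun h => nmul (comp grA.1 x h) a)).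
      by move=> h; rewrite -mulgA mulVg mulg1.
    have [S xS] := finfam_fs (comp grA.1 x); exists S => h /xS ->.
    exact: lin0 (nmul_linl a).
  - move=> h; rewrite -{1}[h]mulg1 -(mulVg s) mulgA.
    exact: graded_mul (comp_in _ _ _) sa.
  - rewrite {1}(comp_sum grA.1 x) (fsum_hom (nmul_linl a));
    last exact: finfam_fs.
    apply: (@fsum_reindex _ _ _ _ (fun h => h * s^-1)%g).
    by exists (fun h => h * s)%g => h; rewrite -mulgA ?mulVg ?mulgV mulg1.
by rewrite cE /c -mulgA mulgV mulg1.
Qed.
End GradedAlg.

Section Resolve.
Variables (k : comPzRingType) (I : choiceType) (M : lmodType k).

(** The operators m i sum to the identity at x, with only finitely many of them
nonzero at x. *)
Definition resolves (m : I -> M -> M) (x : M) : Prop :=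
  finfam (fun i => m i x) /\ fsum (fun i => m i x) = x.

Lemma resolves_submod (m : I -> M -> M) : (forall i, linear (m i)) ->
  is_submodule [set x | resolves m x].
Proof.
move=> ml; split=> [|c x y [xf xE] [yf yE]].
  by split; [exists fset0 => i _|apply: fsum0 => i]; exact: lin0 (ml i).
have E : (fun i => m i (c *: x + y)) = fun i => c *: m i x + m i y.
  by apply/funext => i; exact: ml.
by split; rewrite E; [exact: finfam_lin|rewrite fsum_lin // xE yE].
Qed.
End Resolve.

(** The family p sums to the identity multiplier of A in the strict topology. *)
Definition strict_unit (k : comPzRingType) (A : nuAlgType k) (I : choiceType)
    (p : I -> A) : Prop :=
  forall a, resolves (fun i a => nmul (p i) a) a /\
            resolves (fun i a => nmul a (p i)) a.

Section LocalUnits.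
Variables (k : comPzRingType) (A : nuAlgType k) (E : set A).
Hypothesis luE : orthogonal_local_units E.

(** Families are indexed by all of A rather than by a subtype, with value 0 off
E. *)
Definition idem_of (e : A) : A := if pselect (E e) then e else 0.

(** By orthogonality the component of a in A e is a e itself, and the one in e A
is e a, so the two direct sum decompositions are the two strict sums. *)
Lemma strict_unit_idem : strict_unit idem_of.
Proof.
have [idE ortE dl dr] := luE => a; split.
- have [c [[cE c0 aE] _]] := dr.2 a.
  have ce e : nmul (idem_of e) a = c e.
    rewrite /idem_of; case: pselect => [Ee|nE]; last first.
      by rewrite (lin0 (nmul_linl a)) c0.
    have {1}-> : a = fsum c.
      rewrite {1}aE; apply: fsbig_widen => // i [_ nEi]; exact: c0.
    rewrite (fsum_hom (nmul_linr e)); last exact: finfam_fs.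
    rewrite (fsum1 (i0 := e)) => [|i /eqP ie].
      by have [b _ <-] := cE e Ee; rewrite nmulA idE.
    have [Ei|nEi] := pselect (E i); last first.
      by rewrite c0 // (lin0 (nmul_linr e)).
    have [b _ <-] := cE i Ei; rewrite nmulA (ortE e i Ee Ei (nesym ie)).
    exact: lin0 (nmul_linl b).
  have -> : resolves (fun i a => nmul (idem_of i) a)
    a = (finfam c /\ fsum c = a).
    by rewrite /resolves (_ : (fun i => _) = c) //; apply/funext.
  split; first exact: finfam_fs.
  rewrite {1}aE; apply/esym/fsbig_widen => // i [_ nEi]; exact: c0.
- have [c [[cE c0 aE] _]] := dl.2 a.
  have ce e : nmul a (idem_of e) = c e.
    rewrite /idem_of; case: pselect => [Ee|nE]; last first.
      by rewrite (lin0 (nmul_linr a)) c0.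
    have {1}-> : a = fsum c.
      rewrite {1}aE; apply: fsbig_widen => // i [_ nEi]; exact: c0.
    rewrite (fsum_hom (nmul_linl e)); last exact: finfam_fs.
    rewrite (fsum1 (i0 := e)) => [|i /eqP ie].
      by have [b _ <-] := cE e Ee; rewrite -nmulA idE.
    have [Ei|nEi] := pselect (E i); last first.
      by rewrite c0 // (lin0 (nmul_linl e)).
    have [b _ <-] := cE i Ei; rewrite -nmulA (ortE i e Ei Ee ie).
    exact: lin0 (nmul_linr b).
  have -> : resolves (fun i a => nmul a (idem_of i))
    a = (finfam c /\ fsum c = a).
    by rewrite /resolves (_ : (fun i => _) = c) //; apply/funext.
  split; first exact: finfam_fs.
  rewrite {1}aE; apply/esym/fsbig_widen => // i [_ nEi]; exact: c0.
Qed.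
End LocalUnits.

Lemma resolves_comp (k : comPzRingType) (I : choiceType) (M N : lmodType k)
  (h : M -> N) (m : I -> M -> M) (n : I -> N -> N) x : linear h ->
  (forall i, h (m i x) = n i (h x)) -> resolves m x -> resolves n (h x).
Proof.
move=> hl hm [mf mE]; have E : (fun i => n i (h x)) = fun i => h (m i x).
  by apply/funext => i; rewrite hm.
split; rewrite E; last by rewrite -fsum_hom // mE.
by apply: (finfam_comp (h := fun=> h)) mf => i; exact: lin0.
Qed.

Section HomogUnit.
Variables (k : comPzRingType) (G : groupType) (A : nuAlgType k).
Variable gA : G -> set A.
Hypothesis grA : graded_algebra gA.

(** The degree-1 components of a strict unit form a strict unit. For a of degree
g, the product of a with the degree-1 component of u i is the component of
degree g of a (u i), so the sum is obtained by applying a component map to the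
sum for u, and finiteness is inherited. *)
Lemma strict_unit_comp (I : choiceType) (u : I -> A) : strict_unit u ->
  strict_unit (fun i => comp grA.1 (u i) 1%g).
Proof.
move=> su a; split.
- apply: (homog_ind grA.1 (V := [set a | resolves _ a])) a.
    by apply: resolves_submod => i; exact: nmul_linr.
  move=> g a ga /=; rewrite -(comp_homog grA.1 ga).
  apply: (resolves_comp (comp_linear grA.1 g) _ (su a).1) => i /=.
  by rewrite (comp_homog grA.1 ga) -(comp_mulr grA _ _ ga) mul1g.
- apply: (homog_ind grA.1 (V := [set a | resolves _ a])) a.
    by apply: resolves_submod => i; exact: nmul_linl.
  move=> g a ga /=; rewrite -(comp_homog grA.1 ga).
  apply: (resolves_comp (comp_linear grA.1 g) _ (su a).2) => i /=.
  by rewrite (comp_homog grA.1 ga) -(comp_mull grA _ _ ga) mulg1.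
Qed.
End HomogUnit.

Section Transport.
Variables (k : comPzRingType) (I J : choiceType) (E : set I) (f : I -> J).
Hypothesis finj : forall x y, E x -> E y -> f x = f y -> x = y.

(** Used to index by the set of matrix indices a family first indexed by E. *)
Definition extend_along (M : lmodType k) (F : I -> M) (j : J) : M :=
  if pselect (exists2 i, E i & f i = j) is left h
  then F (projT1 (cid2 h)) else 0.

Lemma extend_alongE (M : lmodType k) (F : I -> M) i : E i ->
  extend_along F (f i) = F i.
Proof.
move=> Ei; rewrite /extend_along; case: pselect => [h|[]]; last by exists i.
by case: cid2 => i' /= Ei' /(finj Ei' Ei) ->.
Qed.

Lemma extend_along_comp (M N : lmodType k) (h : M -> N) (F : I -> M) j :
  h 0 = 0 ->
  h (extend_along F j) = extend_along (fun i => h (F i)) j.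
Proof. by move=> h0; rewrite /extend_along; case: pselect. Qed.

Lemma finfam_extend_along (M : lmodType k) (F : I -> M) : finfam F ->
  finfam (extend_along F).
Proof.
move=> [S FS]; exists [fset f i | i in S]%fset => j; rewrite /extend_along.
case: pselect => // h; case: cid2 => i /= Ei <- ifS; apply: FS.
by apply: contraNN ifS => iS; apply/imfsetP; exists i.
Qed.

Lemma fsum_extend_along (M : lmodType k) (F : I -> M) :
  (forall i, ~ E i -> F i = 0) ->
  fsum (extend_along F) = fsum F.
Proof.
move=> F0; transitivity (\sum_(j \in f @` E) extend_along F j).
  apply/esym/fsbig_widen => // j [_ nj]; rewrite /= /extend_along.
  by case: pselect => // -[i Ei fi]; case: nj; exists i.
rewrite fsbig_image; last by move=> x y /set_mem Ex /set_mem Ey; exact: finj.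
transitivity (\sum_(i \in E) F i).
  by apply: eq_fsbigr => i /set_mem; exact: extend_alongE.
by apply: fsbig_widen => // i [_]; exact: F0.
Qed.

Lemma strict_unit_extend_along (A : nuAlgType k) (p : I -> A) :
  (forall i, ~ E i -> p i = 0) -> strict_unit p -> strict_unit (extend_along p).
Proof.
move=> p0 sp a; have [[lf lE] [rf rE]] := sp a; split; split.
- rewrite (_ : (fun i => _) = extend_along (fun i => nmul (p i) a)).
    exact: finfam_extend_along.
  by apply/funext => j;
    rewrite -(extend_along_comp (h := nmul^~ a)) // (lin0 (nmul_linl a)).
- rewrite (_ : (fun i => _) = extend_along (fun i => nmul (p i) a)).
    by rewrite fsum_extend_along // => i /p0 ->; rewrite (lin0 (nmul_linl a)).
  by apply/funext => j;
    rewrite -(extend_along_comp (h := nmul^~ a)) // (lin0 (nmul_linl a)).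
- rewrite (_ : (fun i => _) = extend_along (fun i => nmul a (p i))).
    exact: finfam_extend_along.
  by apply/funext => j;
    rewrite -(extend_along_comp (h := nmul a)) // (lin0 (nmul_linr a)).
- rewrite (_ : (fun i => _) = extend_along (fun i => nmul a (p i))).
    by rewrite fsum_extend_along // => i /p0 ->; rewrite (lin0 (nmul_linr a)).
  by apply/funext => j;
    rewrite -(extend_along_comp (h := nmul a)) // (lin0 (nmul_linr a)).
Qed.

End Transport.

(** The form in which the local units are used: a strict unit of degree 1
indexed by the set over which the matrices are taken. *)
Lemma homog_strict_unit (k : comPzRingType) (G : groupType) (A : nuAlgType k)
    (gA : G -> set A) (E : set A) (L : choiceType) :
  graded_algebra gA -> orthogonal_local_units E ->
  infinite_set [set: L] -> (E #<= [set: L]) ->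
  exists p : L -> A, (forall i, gA 1%g (p i)) /\ strict_unit p.
Proof.
move=> grA luE infL leE.
have [f finj] : exists f : A -> L, forall x y, E x -> E y -> f x = f y -> x = y.
  have [[x Ex]|nE] := pselect (exists x, E x).
    by apply: inj_of_card_le => //; exists x.
  have [l _] := infinite_setN0 infL; exists (fun=> l) => x y Ex.
  by case: nE; exists x.
exists (extend_along E f (fun e => comp grA.1 (idem_of E e) 1%g)); split.
  move=> i; rewrite /extend_along; case: pselect => [h|_];
    last exact: submod0 (component_submod grA.1 _).
  exact: comp_in.
apply: strict_unit_extend_along => //.
  move=> e nE; rewrite /idem_of; case: pselect => //= _.
  exact: lin0 (comp_linear grA.1 _).
exact/strict_unit_comp/strict_unit_idem.
Qed.

(** * Factoring the unit through a Morita context *)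

Section ContextLemmas.
Variables (k : comPzRingType) (A B : nuAlgType k) (C : morita_context A B).
Implicit Types (x : mX C) (y : mY C) (a : A) (b : B).

Definition xyA x y : A := tauA (tens x y).
Definition yxB y x : B := tauB (tens y x).

Lemma xyA_lact a x y : xyA (lact a x) y = nmul a (xyA x y).
Proof.
have [_ h _] := tauA_map C; rewrite /xyA -h; congr (tauA _).
exact/esym/tensor_lactE.
Qed.
Lemma xyA_ract x y a : xyA x (ract y a) = nmul (xyA x y) a.
Proof.
have [_ _ h] := tauA_map C; rewrite /xyA -h; congr (tauA _).
exact/esym/tensor_ractE.
Qed.
Lemma xyA_linl y : linear (xyA^~ y).
Proof. by move=> c u v; rewrite /xyA tensDl tensZl; have [-> _ _] :=
  tauA_map C. Qed.
Lemma xyA_linr x : linear (xyA x).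
Proof. by move=> c u v; rewrite /xyA tensDr tensZr; have [-> _ _] :=
  tauA_map C. Qed.

Lemma yxB_lact b y x : yxB (lact b y) x = nmul b (yxB y x).
Proof.
have [_ h _] := tauB_map C; rewrite /yxB -h; congr (tauB _).
exact/esym/tensor_lactE.
Qed.
Lemma yxB_ract y x b : yxB y (ract x b) = nmul (yxB y x) b.
Proof.
have [_ _ h] := tauB_map C; rewrite /yxB -h; congr (tauB _).
exact/esym/tensor_ractE.
Qed.
Lemma yxB_balanced y a x : yxB (ract y a) x = yxB y (lact a x).
Proof. by rewrite /yxB tens_balanced. Qed.
Lemma yxB_linl x : linear (yxB^~ x).
Proof. by move=> c u v; rewrite /yxB tensDl tensZl; have [-> _ _] :=
  tauB_map C. Qed.
Lemma yxB_linr y : linear (yxB y).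
Proof. by move=> c u v; rewrite /yxB tensDr tensZr; have [-> _ _] :=
  tauB_map C. Qed.

Lemma xyA_yxB x y x' : lact (xyA x y) x' = ract x (yxB y x').
Proof. exact: tau_compatX. Qed.
Lemma yxB_xyA y x y' : lact (yxB y x) y' = ract y (xyA x y').
Proof. exact: tau_compatY. Qed.

(** The theory is symmetric in A and B; statements on B are those on A for this
context. *)
Definition swap_context : morita_context B A :=
  MoritaContext (tauB_map C) (tauA_map C) (@tau_compatY _ _ _ C)
    (@tau_compatX _ _ _ C).

(** A factorization of the unit of A through the context as a locally finite sum
of products x_i y_i. Finiteness on each factor, not only on the products, is
what makes x and y define finitely supported coordinates. *)
Record frame (I : choiceType) (X1 : set (mX C)) (Y1 : set (mY C))
    (x : I -> mX C) (y : I -> mY C) : Prop := Frame {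
  frame_x : forall i, X1 (x i);
  frame_y : forall i, Y1 (y i);
  frame_lact : forall a, finfam (fun i => lact a (x i));
  frame_ract : forall a, finfam (fun i => ract (y i) a);
  frame_unit : strict_unit (fun i => xyA (x i) (y i))
}.

(** From a strict unit p in A1, and A1 spanned by the products of X1 and Y1, a
frame in X1 and Y1 is built. Here q i is the sum of the finitely many p l for
which p l p i or p i p l is nonzero; it is a local unit for p i, and it is still
locally finite in i because l occurs in q i for only finitely many i. *)
Section Factor.
Variables (I : choiceType) (p : I -> A).
Variables (A1 : set A) (X1 : set (mX C)) (Y1 : set (mY C)).
Hypotheses (pu : strict_unit p) (pA : forall i, A1 (p i)).
Hypotheses (sA : is_submodule A1) (sX : is_submodule X1) (sY : is_submodule Y1).
Hypothesis A1_XY : A1 `<=` spanprod xyA X1 Y1.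
Hypothesis AX : forall a x, A1 a -> X1 x -> X1 (lact a x).
Hypothesis YA : forall y a, Y1 y -> A1 a -> Y1 (ract y a).

Let F l i : A * A := (nmul (p l) (p i), nmul (p i) (p l)).

Let finF l : finfam (F l).
Proof.
have [S [S1 S2]] := finfam2 (pu (p l)).1.1 (pu (p l)).2.1.
by exists S => i iS; rewrite /F S1 // S2.
Qed.

Let finF' i : finite_set [set l | F l i != 0].
Proof.
apply/asboolP/finfamP; have [S FS] := finF i; exists S => l /FS.
by rewrite /F => -[-> ->].
Qed.

Let s i : {fset I} := fset_set [set l | F l i != 0].
Let q i : A := \sum_(l <- s i) p l.

Let sP l i : (l \in s i) = (F l i != 0).
Proof. by rewrite /s in_fset_set //; apply/idP/idP => [/set_mem//|h];
  apply/mem_set. Qed.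

Let qA i : A1 (q i).
Proof. exact: submod_sum. Qed.

Let qp i : nmul (q i) (p i) = p i.
Proof.
rewrite -[RHS](pu (p i)).1.2
  (fsumE (S := s i)) /q ?(lin_sum (nmul_linl (p i))) //.
by move=> l; rewrite sP negbK => /eqP[].
Qed.

Let pq i : nmul (p i) (q i) = p i.
Proof.
rewrite -[RHS](pu (p i)).2.2
  (fsumE (S := s i)) /q ?(lin_sum (nmul_linr (p i))) //.
by move=> l; rewrite sP negbK => /eqP[].
Qed.

Let finq a : finfam (fun i => (nmul a (q i), nmul (q i) a)).
Proof.
have [S [S1 S2]] := finfam2 (pu a).1.1 (pu a).2.1.
have [T FT] := finfam_bound S finF.
exists T => i iT; rewrite /q (lin_sum (nmul_linr a)) (lin_sum (nmul_linl a)).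
congr (_, _); apply: big1_seq => l /andP[_]; rewrite sP => Fl.
  by apply: S2; apply: contraNN Fl => lS; rewrite FT.
by apply: S1; apply: contraNN Fl => lS; rewrite FT.
Qed.

(** The factors of p i are multiplied by q i on the outside: the products still
sum to p i, and the families inherit the local finiteness of q. *)
Lemma ex_frame : exists (x : nat * I -> mX C) (y : nat * I -> mY C),
  frame X1 Y1 x y.
Proof.
have [r rP] : {r : I -> seq (mX C * mY C) & forall i,
    (forall z, z \in r i -> X1 z.1 /\ Y1 z.2) /\
    p i = \sum_(z <- r i) xyA z.1 z.2}.
  apply: (choice (P := fun i (r : seq (mX C * mY C)) =>
    (forall z, z \in r -> X1 z.1 /\ Y1 z.2) /\
      p i = \sum_(z <- r) xyA z.1 z.2)).
  move=> i; have [r r1 r2] := spanprod_sum xyA_linl sX (A1_XY (pA i)).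
  by exists r.
pose n (j : nat) i := nth (0, 0) (r i) j.
have nXY j i : X1 (n j i).1 /\ Y1 (n j i).2.
  rewrite /n; have [jr|jr] := ltnP j (size (r i)).
    by apply: (rP i).1; exact: mem_nth.
  by rewrite nth_default //=; split; exact: submod0.
have n0 j i : (size (r i) <= j)%N -> n j i = (0, 0).
  by move=> ji; rewrite /n nth_default.
have finn (M : lmodType k) (h : I -> mX C * mY C -> M) i : h i (0, 0) = 0 ->
    finfam (fun j => h i (n j i)).
  move=> h0; exists (seq_fset tt (iota 0 (size (r i)))) => j.
  by rewrite seq_fsetE mem_iota -leqNgt => /n0 ->.
(* Term number j of the factorization of p i, enclosed in the local unit q i. *)
pose x (ji : nat * I) := lact (q ji.2) (n ji.1 ji.2).1.
pose y (ji : nat * I) := ract (n ji.1 ji.2).2 (q ji.2).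
have fx a : finfam (fun i => lact a (x i)).
  have [S qS] := finq a.
  apply: (@finfam_pair _ _ _ _ (fun i j => lact a (x (j, i))) S).
    move=> i iS j; rewrite /x -lactA; have [-> _] := qS i iS.
    exact: lin0 (lact_linl _).
  move=> i; apply: (finn _ (fun i z => lact a (lact (q i) z.1))).
  by rewrite !(lin0 (lact_linr _)).
have fy a : finfam (fun i => ract (y i) a).
  have [S qS] := finq a.
  apply: (@finfam_pair _ _ _ _ (fun i j => ract (y (j, i)) a) S).
    move=> i iS j; rewrite /y -ractA; have [_ ->] := qS i iS.
    exact: lin0 (ract_linr _).
  move=> i; apply: (finn _ (fun i z => ract (ract z.2 (q i)) a)).
  by rewrite !(lin0 (ract_linl _)).
have tn i : fsum (fun j => xyA (n j i).1 (n j i).2) = p i.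
  rewrite (rP i).2 (@fsum_nat _ _ _ (size (r i))) => [|j /n0 ->]; last first.
    exact: lin0 (xyA_linl _).
  by rewrite [RHS](big_nth (0, 0)) /index_iota subn0.
have ft i : finfam (fun j => xyA (n j i).1 (n j i).2).
  by apply: (finn _ (fun i z => xyA z.1 z.2)); exact: lin0 (xyA_linl _).
exists x, y; split.
- by move=> [j i]; apply: AX; [exact: qA|exact: (nXY j i).1].
- by move=> [j i]; apply: YA; [exact: (nXY j i).2|exact: qA].
- exact: fx.
- exact: fy.
have inner (h : A -> A) i : linear h ->
    fsum (fun j => h (xyA (x (j, i)) (y (j, i)))) = h (p i).
  (* Summing over j first gives q i p i q i = p i. *)
  move=> hl; pose h' z := h (nmul (nmul (q i) z) (q i)).
  have h'l : linear h' by move=> c u v; rewrite /h' nmul_linr nmul_linl hl.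
  have -> : h (p i) = h' (p i) by rewrite /h' qp pq.
  rewrite -(tn i) (fsum_hom h'l) //; apply: eq_fsum => j.
  by rewrite /x /y /h' xyA_lact xyA_ract nmulA.
have fl a : finfam (fun i => nmul (xyA (x i) (y i)) a).
  have [S yS] := fy a; exists S => i /yS; rewrite -xyA_ract => ->.
  exact: lin0 (xyA_linr _).
have fr a : finfam (fun i => nmul a (xyA (x i) (y i))).
  have [S xS] := fx a; exists S => i /xS; rewrite -xyA_lact => ->.
  exact: lin0 (xyA_linl _).
have pairE M (h : nat * I -> M) : h = fun p => h (p.1, p.2).
  by apply/funext => -[].
move=> a; split; split; [exact: fl| |exact: fr|].
- have := fl a; rewrite (pairE _ (fun i => nmul (xyA (x i) (y i)) a)).
  move=> /(fsum_pairC (F := fun i j => nmul (xyA (x (j, i)) (y (j, i))) a)) ->.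
  rewrite -[RHS](pu a).1.2; apply: eq_fsum => i.
  exact: (inner (nmul^~ a) i (nmul_linl a)).
- have := fr a; rewrite (pairE _ (fun i => nmul a (xyA (x i) (y i)))).
  move=> /(fsum_pairC (F := fun i j => nmul a (xyA (x (j, i)) (y (j, i))))) ->.
  rewrite -[RHS](pu a).2.2; apply: eq_fsum => i.
  exact: (inner (nmul a) i (nmul_linr a)).
Qed.
End Factor.
End ContextLemmas.

Lemma strict_unit_reindex (k : comPzRingType) (A : nuAlgType k)
    (I J : choiceType) (h : J -> I) (p : I -> A) : bijective h ->
  strict_unit p -> strict_unit (fun j => p (h j)).
Proof.
move=> hb pu a; have [g hg _] := hb.
have [[lf lE] [rf rE]] := pu a; split; split.
- exact: (finfam_inj hg (F := fun i => nmul (p i) a)).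
- by rewrite -[RHS]lE [RHS](fsum_reindex _ hb).
- exact: (finfam_inj hg (F := fun i => nmul a (p i))).
- by rewrite -[RHS]rE [RHS](fsum_reindex _ hb).
Qed.

Lemma frame_reindex (k : comPzRingType) (A B : nuAlgType k)
    (C : morita_context A B) (I J : choiceType) (h : J -> I) X1 Y1
    (x : I -> mX C) (y : I -> mY C) : bijective h -> frame X1 Y1 x y ->
  frame X1 Y1 (fun j => x (h j)) (fun j => y (h j)).
Proof.
move=> hb [xX yY fx fy u]; have [g hg _] := hb; split=> //.
- by move=> a; exact: (finfam_inj hg (F := fun i => lact a (x i))).
- by move=> a; exact: (finfam_inj hg (F := fun i => ract (y i) a)).
- exact: (strict_unit_reindex (p := fun i => xyA (x i) (y i))).
Qed.

Section RegularPair.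
Variables (k : comPzRingType) (B : nuAlgType k) (I : choiceType) (u : I -> B).
Hypothesis su : strict_unit u.

Lemma reg_nondegr (b : B) : (forall c, nmul c b = 0) -> b = 0.
Proof. by move=> b0; rewrite -(su b).1.2; apply: fsum0 => i; exact: b0. Qed.
Lemma reg_nondegl (b : B) : (forall c, nmul b c = 0) -> b = 0.
Proof. by move=> b0; rewrite -(su b).2.2; apply: fsum0 => i; exact: b0. Qed.

(** B as a dual pair over itself by left and right multiplication; a strict unit
makes the product nondegenerate. *)
Definition reg_pair (B1 : set B) (sB : is_submodule B1) : dpair B :=
  DPair (@nmul_linl k B) (@nmul_linr k B) reg_nondegr reg_nondegl sB.
End RegularPair.

Section ContextPair.
Variables (k : comPzRingType) (A B : nuAlgType k) (C : morita_context A B).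
Variables (I : choiceType) (X1 : set (mX C)) (Y1 : set (mY C)) (B1 : set B).
Variables (x : I -> mX C) (y : I -> mY C).
Hypothesis fr : frame X1 Y1 x y.
Hypothesis genX : forall V : set (mX C), is_submodule V ->
  (forall a v, V (lact a v)) -> forall v, V v.
Hypothesis genY : forall V : set (mY C), is_submodule V ->
  (forall v a, V (ract v a)) -> forall v, V v.

Lemma frame_finX v : finfam (fun i => yxB (y i) v).
Proof.
apply: (genX (V := [set v | finfam (fun i => yxB (y i) v)])) v => [|a v].
  split=> [|c u v uf vf]; first by exists fset0 => i _;
    exact: lin0 (yxB_linr _).
  rewrite /= (_ : (fun i => _) = fun i => c *: yxB (y i) u + yxB (y i) v).
    exact: finfam_lin.
  by apply/funext => i; exact: yxB_linr.
have [S yS] := frame_ract fr a; exists S => i /yS; rewrite -yxB_balanced => ->.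
exact: lin0 (yxB_linl _).
Qed.

(** The relation x (y v) = (x y) v transports a resolution of a in A to one of
the vectors a v, and these generate X. *)
Lemma frame_resolveX v : resolves (fun i v => ract (x i) (yxB (y i) v)) v.
Proof.
apply: (genX (V := [set v | resolves _ v])) v => [|a v].
  by apply: resolves_submod => i c u v; rewrite yxB_linr ract_linr.
apply: (resolves_comp (h := lact^~ v) (lact_linl v) _ (frame_unit fr a).1) => i.
by rewrite lactA xyA_yxB.
Qed.

Lemma frame_finY w : finfam (fun i => yxB w (x i)).
Proof.
apply: (genY (V := [set w | finfam (fun i => yxB w (x i))])) w => [|w a].
  split=> [|c u v uf vf]; first by exists fset0 => i _;
    exact: lin0 (yxB_linl _).
  rewrite /= (_ : (fun i => _) = fun i => c *: yxB u (x i) + yxB v (x i)).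
    exact: finfam_lin.
  by apply/funext => i; exact: yxB_linl.
have [S xS] := frame_lact fr a; exists S => i /xS; rewrite yxB_balanced => ->.
exact: lin0 (yxB_linr _).
Qed.

Lemma frame_resolveY w : resolves (fun i w => lact (yxB w (x i)) (y i)) w.
Proof.
apply: (genY (V := [set v | resolves _ v])) w => [|w a].
  by apply: resolves_submod => i c u v; rewrite yxB_linl lact_linl.
apply: (resolves_comp (h := ract w) (ract_linr w) _ (frame_unit fr a).2) => i.
by rewrite ractA yxB_xyA.
Qed.

Lemma ctx_nondegr v : (forall w : mY C, yxB w v = 0) -> v = 0.
Proof.
move=> v0; rewrite -(frame_resolveX v).2; apply: fsum0 => i.
by rewrite v0 (lin0 (ract_linr _)).
Qed.
Lemma ctx_nondegl w : (forall v : mX C, yxB w v = 0) -> w = 0.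
Proof.
move=> w0; rewrite -(frame_resolveY w).2; apply: fsum0 => i.
by rewrite w0 (lin0 (lact_linl _)).
Qed.

Hypothesis sY : is_submodule Y1.
(** X with covectors Y, by the product with values in B; a frame makes it
nondegenerate. *)
Definition ctx_pair : dpair B :=
  DPair (@yxB_linl _ _ _ C) (@yxB_linr _ _ _ C) ctx_nondegr ctx_nondegl sY.

Variables (u : I -> B) (su : strict_unit u) (sB : is_submodule B1).
Hypothesis BY : forall b w, B1 b -> Y1 w -> Y1 (lact b w).
Hypothesis YX : forall w v, Y1 w -> X1 v -> B1 (yxB w v).

(** A vector v of X is recovered from its coordinates y_i v in B as the sum of
the x_i (y_i v). The adjoint of taking coordinates is recombination of
covectors. *)
Lemma ctx_summand_reg : summand ctx_pair (fs_pair I (reg_pair su sB)).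
Proof.
pose a (v : mX C) : finsupp I B := finsupp_of (fun i => yxB (y i) v).
pose a' (c : finsupp I B) : mY C := fsum (fun i => lact (c i) (y i)).
pose b (c : finsupp I B) : mX C := fsum (fun i => ract (x i) (c i)).
pose b' (w : mY C) : finsupp I B := finsupp_of (fun i => yxB w (x i)).
have fa' (c : finsupp I B) : finfam (fun i => lact (c i) (y i)).
  have [S cS] := finfam_fs c; exists S => i /cS ->; exact: lin0 (lact_linl _).
have fb (c : finsupp I B) : finfam (fun i => ract (x i) (c i)).
  have [S cS] := finfam_fs c; exists S => i /cS ->; exact: lin0 (ract_linr _).
exists a, a', b, b'; split.
- split=> [c v|c cD]; last first.
    by apply: fsum_submod => // i; apply: BY; [exact: cD|exact: frame_y fr i].
  rewrite /= /fs_pr /= finsupp_ofE; last exact: frame_finX.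
  rewrite /a' (fsum_hom (h := fun w => yxB w v) (yxB_linl v)) //.
  by apply: eq_fsum => i; rewrite yxB_lact.
- split=> [w c|w wD i]; last first.
    rewrite /b' finsupp_ofE; last exact: frame_finY.
    by apply: YX wD _; exact: frame_x fr i.
  rewrite /= /fs_pr /= finsupp_ofE; last exact: frame_finY.
  rewrite /b (fsum_hom (h := yxB w) (yxB_linr w)) //.
  by apply: eq_fsum => i; rewrite yxB_ract.
- move=> v; rewrite /b /a finsupp_ofE; last exact: frame_finX.
  exact: (frame_resolveX v).2.
Qed.

Variables (w : I -> mY C) (z : I -> mX C).
Hypothesis fr' : frame (C := swap_context C) Y1 X1 w z.

(** With a frame w_i z_i of B, the coordinates of b are the z_i b in X. *)
Lemma reg_summand_ctx : summand (reg_pair su sB) (fs_pair I ctx_pair).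
Proof.
pose a (c : B) : finsupp I (mX C) := finsupp_of (fun i => ract (z i) c).
pose a' (v : finsupp I (mY C)) : B := fsum (fun i => yxB (v i) (z i)).
pose b (v : finsupp I (mX C)) : B := fsum (fun i => yxB (w i) (v i)).
pose b' (c : B) : finsupp I (mY C) := finsupp_of (fun i => lact c (w i)).
have fa' (v : finsupp I (mY C)) : finfam (fun i => yxB (v i) (z i)).
  have [S cS] := finfam_fs v; exists S => i /cS ->; exact: lin0 (yxB_linl _).
have fb (v : finsupp I (mX C)) : finfam (fun i => yxB (w i) (v i)).
  have [S cS] := finfam_fs v; exists S => i /cS ->; exact: lin0 (yxB_linr _).
have fz c : finfam (fun i => ract (z i) c) := frame_ract fr' c.
have fw c : finfam (fun i => lact c (w i)) := frame_lact fr' c.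
exists a, a', b, b'; split.
- split=> [v c|v vD]; last first.
    by apply: fsum_submod => // i; apply: YX; [exact: vD|exact: frame_y fr' i].
  rewrite /= /fs_pr /= finsupp_ofE //.
  rewrite /a' (fsum_hom (h := nmul^~ c) (nmul_linl c)) //.
  by apply: eq_fsum => i; rewrite yxB_ract.
- split=> [c v|c cD i]; last first.
    by rewrite /b' finsupp_ofE //; apply: BY cD _; exact: frame_x fr' i.
  rewrite /= /fs_pr /= finsupp_ofE //.
  rewrite /b (fsum_hom (h := nmul c) (nmul_linr c)) //.
  by apply: eq_fsum => i; rewrite yxB_lact.
- move=> c; rewrite /b /a finsupp_ofE // -[RHS](frame_unit fr' c).1.2.
  by apply: eq_fsum => i; rewrite yxB_ract.
Qed.

End ContextPair.

(** * Matrices as finite-rank operators *)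

(** The vectors of degree t, read off from their products with the covectors of
degree 1. *)
Definition vec_deg (k : comPzRingType) (T : Type) (B : lmodType k)
    (gB : T -> set B) (P : dpair B) (t : T) : set (vec P) :=
  [set v | forall w, covec1 w -> gB t (form w v)].

Section RankOne.
Variables (k : comPzRingType) (G : groupType) (B : nuAlgType k).
Variable gB : G -> set B.

(** A is a graded algebra of finite-rank operators on the vectors of P: it acts
faithfully, th v w acts as v' |-> v (w v'), and each A_t is spanned by the th v
w with v of degree t and w of degree 1. *)
Record rank_one_alg (A : nuAlgType k) (gA : G -> set A) (P : dpair B)
    (act : A -> vec P -> vec P) (th : vec P -> covec P -> A) : Prop :=
  RankOneAlg {
  roa_linl : forall v, linear (act^~ v);
  roa_linr : forall a, linear (act a);
  roa_mul : forall a a' v, act (nmul a a') v = act a (act a' v);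
  roa_faithful : forall a, (forall v, act a v = 0) -> a = 0;
  roa_th : forall w' v w v',
    form w' (act (th v w) v') = nmul (form w' v) (form w v');
  roa_th_deg : forall t v w, vec_deg gB t v -> covec1 w -> gA t (th v w);
  roa_span : forall t a, gA t a -> exists2 s : seq (vec P * covec P),
    forall p, p \in s -> vec_deg gB t p.1 /\ covec1 p.2
    & a = \sum_(p <- s) th p.1 p.2
}.

Section MatAct.
Variables (A : nuAlgType k) (gA : G -> set A) (P : dpair B).
Variables (act : A -> vec P -> vec P) (th : vec P -> covec P -> A).
Hypothesis roa : rank_one_alg gA act th.
Variable L : choiceType.
Let linl := roa_linl roa.
Let linr := roa_linr roa.

Definition mat_act (M : FMat L A) (x : finsupp L (vec P)) : finsupp L (vec P) :=
  finsupp_of (fun i => fsum (fun j => act (entry M i j) (x j))).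

Lemma mat_act_finfam (M : FMat L A) (x : finsupp L (vec P)) i :
  finfam (fun j => act (entry M i j) (x j)).
Proof. by have [S xS] := finfam_fs x; exists S => j /xS ->;
  exact: lin0 (linr _). Qed.

Lemma mat_actE (M : FMat L A) (x : finsupp L (vec P)) i :
  mat_act M x i = fsum (fun j => act (entry M i j) (x j)).
Proof.
rewrite /mat_act finsupp_ofE //; have [S MS] := finfam_fs M.
exists [fset p.1 | p in S]%fset => i' i'S; apply: fsum0 => j.
rewrite /entry MS ?(lin0 (linl _)) //; apply: contraNN i'S => ijS.
by apply/imfsetP; exists (i', j).
Qed.

Lemma mat_act_linl x : linear (mat_act^~ x).
Proof.
move=> c M N; apply: finsupp_eq => i; rewrite finsupp_linE !mat_actE.
rewrite -fsum_lin; try exact: mat_act_finfam.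
by apply: eq_fsum => j; rewrite -linl.
Qed.

Lemma mat_act_mul (M N : FMat L A) x :
  mat_act (nmul M N) x = mat_act M (mat_act N x).
Proof.
apply: finsupp_eq => i; rewrite !mat_actE.
have [S MS] := finfam_fs M; have [T NT] := finfam_fs N.
have Mf : finfam (entry M i).
  exists [fset p.2 | p in S]%fset => j jS; apply: MS; apply: contraNN jS => ijS.
  by apply/imfsetP; exists (i, j).
transitivity (fsum (fun l => fsum (fun j =>
    act (entry M i j) (act (entry N j l) (x l))))).
  apply: eq_fsum => l.
  rewrite -[entry _ i l]/(fsum (fun j => nmul (entry M i j) (entry N j l))).
  rewrite (fsum_hom (h := act^~ (x l)) (linl _)).
    by apply: eq_fsum => j; rewrite (roa_mul roa).
  by apply: (finfam_comp (h := fun j m => nmul m _)) Mf => j;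
    exact: lin0 (nmul_linl _).
rewrite (fsum_exchange
  (F := fun l j => act (entry M i j) (act (entry N j l) (x l)))).
  apply: eq_fsum => j; rewrite mat_actE (fsum_hom (linr _)) //;
    exact: mat_act_finfam.
exists [fset (p.2, p.1) | p in T]%fset => -[l j] ljT /=.
rewrite /entry (NT (j, l)) ?(lin0 (linl _)) ?(lin0 (linr _)) //.
by apply: contraNN ljT => jlT; apply/imfsetP; exists (j, l).
Qed.

(** Column vectors with a single entry read off the entries of a matrix. *)
Lemma mat_act_faithful (M N : FMat L A) :
  (forall x, mat_act M x = mat_act N x) -> M = N.
Proof.
move=> MN; apply: FMat_eq => i j; apply/eqP; rewrite -subr_eq0; apply/eqP.
apply: (roa_faithful roa) => v; rewrite (linB (linl v)).
have E (Q : FMat L A) : act (entry Q i j) v = mat_act Q (single j v) i.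
  rewrite mat_actE (fsum1 (i0 := j)) ?singleE ?eqxx // => l /negPf lj.
  by rewrite singleE lj (lin0 (linr _)).
by rewrite !E MN subrr.
Qed.

Lemma mat_act_single i j a x :
  mat_act (single (i, j) a : FMat L A) x = single i (act a (x j)).
Proof.
apply: finsupp_eq => l; rewrite mat_actE singleE /entry.
rewrite (fsum1 (i0 := j)) => [|m /negPf mj].
  rewrite singleE xpair_eqE eqxx andbT; case: eqP => // _; exact: lin0 (linl _).
by rewrite singleE xpair_eqE mj andbF (lin0 (linl _)).
Qed.

Lemma th0l w : th 0 w = 0.
Proof.
apply: (roa_faithful roa) => v; apply: form_nondegr => w'.
by rewrite (roa_th roa) form0r (lin0 (nmul_linl _)).
Qed.
Lemma th0r v : th v 0 = 0.
Proof.
apply: (roa_faithful roa) => v'; apply: form_nondegr => w'.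
by rewrite (roa_th roa) form0l (lin0 (nmul_linr _)).
Qed.

Definition dyad (xi : finsupp L (vec P)) (eta : finsupp L (covec P)) :
  FMat L A :=
  finsupp_of (fun p : L * L => th (xi p.1) (eta p.2)).

Lemma dyadE xi eta i j : entry (dyad xi eta) i j = th (xi i) (eta j).
Proof.
rewrite /entry /dyad finsupp_ofE //; have [S xS] := finfam_fs xi.
have [T eT] := finfam_fs eta.
exists [fset ((i, j) : (L * L)%type) | i in S, j in T]%fset => -[i' j'] ij.
have [iS|/xS -> /=] := boolP (i' \in S); last by rewrite th0l.
have [jT|/eT -> /=] := boolP (j' \in T); last by rewrite th0r.
case/negP: ij; apply/imfset2P; exists i' => //=; by exists j'.
Qed.

(** An operator is determined by its values between covectors and vectors, and
those of a dyad factor, so an isometry carries dyads to dyads. *)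
Lemma fs_pr_dyad xi eta y x : fs_pr y (mat_act (dyad xi eta) x) =
  nmul (fs_pr y xi) (fs_pr eta x).
Proof.
transitivity (fsum (fun i => nmul (form (y i) (xi i)) (fs_pr eta x))).
  apply: eq_fsum => i; rewrite mat_actE.
  rewrite (fsum_hom (h := form (y i)) (form_linr _));
    last exact: mat_act_finfam.
  rewrite (fsum_hom (h := nmul _) (nmul_linr _)); last exact: fs_pr_finl.
  by apply: eq_fsum => j; rewrite dyadE (roa_th roa).
by rewrite -(fsum_hom (h := nmul^~ _) (nmul_linl _)) //; exact: fs_pr_finl.
Qed.

Lemma fs_pr_mat_act_single i j v w y x :
  fs_pr y (mat_act (single (i, j) (th v w) : FMat L A) x) =
  nmul (fs_pr y (single i v)) (fs_pr (single j w) x).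
Proof.
by rewrite mat_act_single !fs_pr_single_r fs_pr_single_l (roa_th roa).
Qed.

End MatAct.

Section Conjugation.
Variables (A1 : nuAlgType k) (gA1 : G -> set A1) (P1 : dpair B).
Variables (act1 : A1 -> vec P1 -> vec P1) (th1 : vec P1 -> covec P1 -> A1).
Hypothesis roa1 : rank_one_alg gA1 act1 th1.
Hypothesis ds1 : direct_sum [set: G] gA1.
Variables (A2 : nuAlgType k) (gA2 : G -> set A2) (P2 : dpair B).
Variables (act2 : A2 -> vec P2 -> vec P2) (th2 : vec P2 -> covec P2 -> A2).
Hypothesis roa2 : rank_one_alg gA2 act2 th2.
Hypothesis sub2 : forall t, is_submodule (gA2 t).
Variable L : choiceType.
Variables (f : finsupp L (vec P1) -> finsupp L (vec P2))
  (f' : finsupp L (covec P2) -> finsupp L (covec P1))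
  (g : finsupp L (vec P2) -> finsupp L (vec P1))
  (g' : finsupp L (covec P1) -> finsupp L (covec P2)).
Hypothesis ff' : @adjoint _ _ (fs_pair L P1) (fs_pair L P2) f f'.
Hypothesis gg' : @adjoint _ _ (fs_pair L P2) (fs_pair L P1) g g'.
Hypotheses (fg : cancel f g).

(** N is f M f^-1, written without the inverse. *)
Definition conjugate (M : FMat L A1) (N : FMat L A2) : Prop :=
  forall x, mat_act act2 N (f x) = f (mat_act act1 M x).

Lemma conjugate_submod (V : set (FMat L A2)) : is_submodule V ->
  is_submodule [set M | exists2 N, V N & conjugate M N].
Proof.
have fl := adjoint_linear ff'.
move=> sV; split; first exists 0; first exact: submod0.
  move=> x; rewrite (lin0 (mat_act_linl roa1 x)) (lin0 (mat_act_linl roa2 _)).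
  exact/esym/(lin0 fl).
move=> c M M' [N VN MN] [N' VN' MN']; exists (c *: N + N'); first exact: sV.2.
move=> x; rewrite (mat_act_linl roa1) (mat_act_linl roa2) MN MN'.
exact/esym/fl.
Qed.

Lemma grading_submod t : is_submodule (FMat_grading L gA2 t).
Proof.
split=> [i j|c M N Mt Nt i j]; first exact: submod0 (sub2 t).
by apply: (sub2 t).2; [exact: Mt|exact: Nt].
Qed.

(** A matrix with one entry th v w is a rank-one operator, and conjugation by an
isometry sends it to the dyad of the transported vector and covector. Degrees
are kept: the covector because g' preserves covec1, the vector because its
degree is tested against covec1, which f' preserves. *)
Lemma conjugate_single t i j a : gA1 t a -> exists2 N,
  FMat_grading L gA2 t N & conjugate (single (i, j) a) N.
Proof.
move=> /(roa_span roa1)[s sP ->].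
rewrite (lin_sum (single_linear (M := A1) (i, j))).
apply: (submod_sum (conjugate_submod (grading_submod t))) => -[v w]
  /sP[/= vt wD].
exists (dyad th2 (f (single i v)) (g' (single j w))) => [i' j'|x].
  rewrite (dyadE roa2); apply: (roa_th_deg roa2).
    move=> w' w'D; rewrite -fs_pr_single_l.
    have /= -> := ff'.1 (single i' w') (single i v).
    rewrite fs_pr_single_r; apply: vt; apply: ff'.2 => l.
    by rewrite singleE; case: eqP => // _; exact: submod0 (covec1_submod P2).
  apply: gg'.2 => l; rewrite singleE; case: eqP => // _.
  exact: submod0 (covec1_submod P1).
apply: (@form_injr _ _ (fs_pair L P2)) => y.
rewrite ff'.1 /= (fs_pr_dyad roa2) (fs_pr_mat_act_single roa1).
have /= -> := ff'.1 y (single i v).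
by have /= <- := gg'.1 (single j w) (f x); rewrite fg.
Qed.

Lemma conjugate_graded t M : FMat_grading L gA1 t M ->
  exists2 N, FMat_grading L gA2 t N & conjugate M N.
Proof.
move=> Mt; rewrite (finsupp_decomp M).
apply: (fsum_submod (conjugate_submod (grading_submod t))).
  by have [S MS] := finfam_fs M; exists S => i /MS ->;
    exact: lin0 (single_linear _).
by move=> [i j]; exact: conjugate_single (Mt i j).
Qed.

(** Every matrix is a sum of matrices with one homogeneous entry. *)
Lemma conjugate_ex M : exists N, conjugate M N.
Proof.
suff [N _ MN] : exists2 N, setT N & conjugate M N by exists N.
have sT : is_submodule [set: FMat L A2] by [].
rewrite (finsupp_decomp M); apply: (fsum_submod (conjugate_submod sT)).
  by have [S MS] := finfam_fs M; exists S => i /MS ->;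
    exact: lin0 (single_linear _).
move=> [i j]; move: (M (i, j)).
apply: (homog_ind ds1
  (V := [set a | exists2 N, setT N & conjugate (single (i, j) a) N])).
  split=> [|c u v uN vN].
    by rewrite /= (lin0 (single_linear _)); exact: (conjugate_submod sT).1.
  by rewrite /= single_linear; exact: (conjugate_submod sT).2.
by move=> t a /(conjugate_single i j)[N _ aN]; exists N.
Qed.

End Conjugation.

Section ConjugationIso.
Variables (A1 : nuAlgType k) (gA1 : G -> set A1) (P1 : dpair B).
Variables (act1 : A1 -> vec P1 -> vec P1) (th1 : vec P1 -> covec P1 -> A1).
Hypothesis roa1 : rank_one_alg gA1 act1 th1.
Hypothesis ds1 : direct_sum [set: G] gA1.
Variables (A2 : nuAlgType k) (gA2 : G -> set A2) (P2 : dpair B).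
Variables (act2 : A2 -> vec P2 -> vec P2) (th2 : vec P2 -> covec P2 -> A2).
Hypothesis roa2 : rank_one_alg gA2 act2 th2.
Hypothesis ds2 : direct_sum [set: G] gA2.
Variable L : choiceType.

(** Faithfulness of the actions makes the conjugate of a matrix unique, so that
conjugation is a function, and all its algebraic properties follow from those of
conjugation of operators. *)
Lemma graded_isomorphism_of_isometric :
  isometric (fs_pair L P1) (fs_pair L P2) ->
  exists phi : FMat L A1 -> FMat L A2,
    graded_isomorphism (FMat_grading L gA1) (FMat_grading L gA2) phi.
Proof.
move=> [f [f' [g [g' [ff' gg' fg gf]]]]].
have [phi phiP] : {phi & forall M, conjugate act1 act2 f M (phi M)}.
  exact: (choice (conjugate_ex roa1 ds1 roa2
    (component_submod ds2) ff' gg' fg)).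
have [psi psiP] : {psi & forall N, conjugate act2 act1 g N (psi N)}.
  exact: (choice (conjugate_ex roa2 ds2 roa1
    (component_submod ds1) gg' ff' gf)).
have uniq1 M N : (forall y, mat_act act1 M (g y) = mat_act act1 N (g y)) ->
  M = N.
  by move=> MN; apply: (mat_act_faithful roa1) => x; rewrite -(fg x) MN.
have uniq2 M N : (forall x, mat_act act2 M (f x) = mat_act act2 N (f x)) ->
  M = N.
  by move=> MN; apply: (mat_act_faithful roa2) => y; rewrite -(gf y) MN.
have phiK : cancel phi psi.
  by move=> M; apply: uniq1 => y; rewrite psiP -{1}(gf y) phiP fg.
have psiK : cancel psi phi.
  by move=> N; apply: uniq2 => x; rewrite phiP -{1}(fg x) psiP gf.
have phi_gr t M : FMat_grading L gA1 t M -> FMat_grading L gA2 t (phi M).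
  move=> /(conjugate_graded roa1 roa2
    (component_submod ds2) ff' gg' fg)[N Nt MN].
  by rewrite (uniq2 (phi M) N) // => x; rewrite phiP MN.
have psi_gr t N : FMat_grading L gA2 t N -> FMat_grading L gA1 t (psi N).
  move=> /(conjugate_graded roa2 roa1
    (component_submod ds1) gg' ff' gf)[M Mt NM].
  by rewrite (uniq1 (psi N) M) // => y; rewrite psiP NM.
exists phi; split.
- move=> c M N; apply: uniq2 => x.
  rewrite phiP (mat_act_linl roa1) (mat_act_linl roa2) !phiP;
    exact: (adjoint_linear ff').
- by move=> M N; apply: uniq2 => x;
  rewrite phiP (mat_act_mul roa1) (mat_act_mul roa2) !phiP.
- by exists psi.
- move=> t; apply/seteqP; split=> [_ [M Mt <-]|N Nt]; first exact: phi_gr.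
  by exists (psi N); [exact: psi_gr|exact: psiK].
Qed.
End ConjugationIso.
End RankOne.

(** * Main theorem: assembling the pieces *)

Section Instances.
Variables (k : comPzRingType) (G : groupType) (B : nuAlgType k).
Variable gB : G -> set B.
Hypothesis grB : graded_algebra gB.
Variables (I : choiceType) (u : I -> B).
Hypotheses (su : strict_unit u) (uB : forall i, gB 1%g (u i)).

(** Every element b of B is the locally finite sum of the products b u_i, which
have a right factor of degree 1. *)
Lemma roa_reg :
  @rank_one_alg k G B gB B gB (reg_pair su (component_submod grB.1 1%g))
    (@nmul k B) (@nmul k B).
Proof.
split=> /=.
- exact: nmul_linl.
- exact: nmul_linr.
- by move=> a a' v; rewrite nmulA.
- exact: reg_nondegl su.
- by move=> w' v w v'; rewrite !nmulA.
- move=> t v w vt wB; rewrite -[t]mulg1; apply: (graded_mul grB) => //.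
  rewrite -(su v).1.2; apply: fsum_submod;
    [exact: component_submod grB.1 t|exact: (su v).1.1|].
  by move=> i; exact: vt.
- move=> t a ta; rewrite -(su a).2.2.
  apply: (fsum_seq (v := fun=> a) (w := u)) => //; first exact: (su a).2.1.
  by move=> i w wB; rewrite -[t]mul1g; exact: (graded_mul grB).
Qed.

Variables (A : nuAlgType k) (gA : G -> set A).
Hypothesis grA : graded_algebra gA.
Variables (C : morita_context A B).
Variables (gX : G -> set (mX C)) (gY : G -> set (mY C)).
Hypothesis gmc : graded_morita_context gA gB gX gY.
Variables (x : I -> mX C) (y : I -> mY C).
Hypothesis fr : frame (gX 1%g) (gY 1%g) x y.
Hypothesis genX : forall V : set (mX C), is_submodule V ->
  (forall a v, V (lact a v)) -> forall v, V v.
Hypothesis genY : forall V : set (mY C), is_submodule V ->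
  (forall v a, V (ract v a)) -> forall v, V v.
Hypothesis sY : is_submodule (gY 1%g).

(** Every a in A is the sum of the (a x_i) y_i, with y_i of degree 1. Conversely
a vector v whose products with Y_1 have degree t is the sum of the x_i (y_i v),
hence of degree t. *)
Lemma roa_ctx :
  @rank_one_alg k G B gB A gA (ctx_pair fr genX genY sY)
    (@lact k A B (mX C)) (@xyA k A B C).
Proof.
have [[dX lX rX] _ tAg tBg] := gmc.
have gl s t a v : gA s a -> gX t v -> gX (s * t)%g (lact a v).
  by move=> sa tv; apply: lX; apply: sub_span; exists a => //; exists v.
have gr s t v b : gX s v -> gB t b -> gX (s * t)%g (ract v b).
  by move=> sv tb; apply: rX; apply: sub_span; exists v => //; exists b.
split=> /=.
- exact: lact_linl.
- exact: lact_linr.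
- exact: lactA.
- move=> a a0; rewrite -(frame_unit fr a).2.2; apply: fsum0 => i.
  by rewrite -xyA_lact a0 (lin0 (xyA_linl _)).
- by move=> w' v w v'; rewrite xyA_yxB yxB_ract.
- move=> t v w vt wY; rewrite -[t]mulg1; apply: tAg => //.
  have [rf <-] := frame_resolveX fr genX v.
  apply: fsum_submod; [exact: dX.1|exact: rf|move=> i].
  by rewrite -[t]mul1g; apply: gr; [exact: frame_x fr i|exact/vt/(frame_y fr)].
- move=> t a ta; rewrite -(frame_unit fr a).2.2.
  rewrite (_ : (fun i => _) = fun i => xyA (lact a (x i)) (y i)); last first.
    by apply/funext => i; rewrite xyA_lact.
  apply: (fsum_seq (v := fun i => lact a (x i)) (w := y)).
  + have [S xS] := frame_lact fr a; exists S => i /xS ->;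
    exact: lin0 (xyA_linl _).
  + move=> i w wY; rewrite /= -[t]mulg1 -[(t * 1)%g]mul1g; apply: tBg => //.
    exact: gl ta (frame_x fr i).
  + exact: frame_y fr.
Qed.
End Instances.

Section IdentityComponent.
Variables (k : comPzRingType) (G : groupType) (A : nuAlgType k).
Variable gA : G -> set A.

(** At t = 1 the condition reads A_1 = A_1 A_1 A_1, and A_1 A_1 lies in A_1. *)
Lemma psg_Dideal1 : partially_strongly_graded gA -> gA 1%g `<=` Dideal gA 1%g.
Proof.
move=> [grA psg]; rewrite {1}psg; apply: span_min; first exact: span_submodule.
move=> _ [d covec1 [a aA <-]]; apply: sub_span; exists d.
  rewrite -[1%g]mulg1 -{2}[1%g]invg1; exact: grA.2 covec1.
by exists a => //; rewrite invg1.
Qed.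
End IdentityComponent.

Section GradedContext.
Variables (k : comPzRingType) (G : groupType) (A B : nuAlgType k).
Variables (gA : G -> set A) (gB : G -> set B).
Variables (C : morita_context A B).
Variables (gX : G -> set (mX C)) (gY : G -> set (mY C)).
Hypothesis grA : graded_algebra gA.
Hypothesis gmc : graded_morita_context gA gB gX gY.

(** Unitality of the homogeneous components makes X = A X. *)
Lemma gen_lact (D : G -> set A) :
  (forall t, spanprod lact (D t) (gX t) = gX t) ->
  forall V : set (mX C), is_submodule V -> (forall a v, V (lact a v)) ->
    forall v, V v.
Proof.
have [[dX _ _] _ _ _] := gmc; move=> DX V sV lV;
  apply: (homog_ind dX) => // t v.
by rewrite -DX; apply: span_min => // _ [a _ [x _ <-]].
Qed.

Lemma gen_ract (D : G -> set A) :
  (forall t, spanprod ract (gY t) (D t) = gY t) ->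
  forall V : set (mY C), is_submodule V -> (forall v a, V (ract v a)) ->
    forall v, V v.
Proof.
have [_ [dY _ _] _ _] := gmc; move=> DY V sV rV;
  apply: (homog_ind dY) => // t v.
by rewrite -DY; apply: span_min => // _ [y _ [a _ <-]].
Qed.

Lemma ex_homog_frame (L : choiceType) (h : L -> nat * L) (p : L -> A) :
  bijective h -> (forall i, gA 1%g (p i)) -> strict_unit p ->
  gA 1%g `<=` spanprod (fun x y => tauA (tens x y)) (gX 1%g) (gY 1%g) ->
  exists (x : L -> mX C) (y : L -> mY C), frame (gX 1%g) (gY 1%g) x y.
Proof.
have [[dX lX _] [dY _ rY] _ _] := gmc; move=> hb pA pu A1_XY.
have [|||a x aA xX|y a yY aA|x [y fr]] :=
  @ex_frame _ _ _ C _ p (gA 1%g) (gX 1%g) (gY 1%g) pu pA _ _ _ A1_XY.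
- exact: component_submod grA.1 _.
- exact: dX.1.
- exact: dY.1.
- by rewrite -[1%g]mulg1; apply: lX; apply: sub_span; exists a => //; exists x.
- by rewrite -[1%g]mulg1; apply: rY; apply: sub_span; exists y => //; exists a.
by exists (fun i => x (h i)), (fun i => y (h i)); exact: frame_reindex hb fr.
Qed.
End GradedContext.

Theorem theorem9p1 (k : comPzRingType) (G : groupType) (A B : nuAlgType k)
    (gA : G -> set A) (gB : G -> set B) (E : set A) (F : set B)
    (psgA : partially_strongly_graded gA)
    (psgB : partially_strongly_graded gB)
    (luE : orthogonal_local_units E) (luF : orthogonal_local_units F)
    (eqvAB : strongly_graded_equivalent gA gB)
    (X : choiceType) (infX : infinite_set [set: X])
    (leEX : E #<= [set: X]) (leFX : F #<= [set: X]) :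
  exists phi : FMat X A -> FMat X B,
    graded_isomorphism (FMat_grading X gA) (FMat_grading X gB) phi.
Proof.
have [C [gX [gY [gmc strong _ spanA spanB]]]] := eqvAB.
have [[dX lX rX] [dY lY rY] tAg tBg] := gmc.
have [grA grB] := (psgA.1, psgB.1).
have [e einj] := nat_inj infX.
have [h hb] := absorb_prod (J := nat) 0%N infX einj.
have [x0 _] := infinite_setN0 infX.
have [h2 h2b] := absorb_prod (J := X) (e := id) x0 infX (fun _ _ => id).
have [h' h'b] : exists h' : X -> nat * X, bijective h'.
  have [hi hK hiK] := hb; exists (fun x => ((hi x).2, (hi x).1)).
  by exists (fun p => h (p.2, p.1)) => [x|[n x]];
    rewrite -?surjective_pairing ?hiK ?hK.
have gmc' : graded_morita_context (C := swap_context C) gB gA gY gX by [].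
have [p [pA pu]] := homog_strict_unit grA luE infX leEX.
have [q [qB qu]] := homog_strict_unit grB luF infX leFX.
have [|x [y fr]] := ex_homog_frame grA gmc h'b pA pu.
  by have := spanA 1%g; rewrite invg1 => ->; exact: psg_Dideal1.
have [|w [z fr']] := ex_homog_frame grB gmc' h'b qB qu.
  by have := spanB 1%g; rewrite invg1 => ->; exact: psg_Dideal1.
have genX := gen_lact gmc (fun t => (strong t).1.1).
have genY := gen_ract gmc (fun t => (strong t).2.2).
have sY := dY.1 1%g I.
have BY b v : gB 1%g b -> gY 1%g v -> gY 1%g (lact b v).
  move=> bB vY; rewrite -[1%g]mulg1; apply: lY; apply: sub_span.
  by exists b => //; exists v.
have YX v v' : gY 1%g v -> gX 1%g v' -> gB 1%g (yxB v v').
  by move=> vY vX; rewrite -[1%g]mulg1; exact: tBg.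
have PQ := ctx_summand_reg fr genX genY sY qu
  (component_submod grB.1 1%g) BY YX.
have QP := reg_summand_ctx fr genX genY sY qu
  (component_submod grB.1 1%g) BY YX fr'.
apply: (graded_isomorphism_of_isometric (roa_ctx gmc fr genX genY sY) grA.1
  (roa_reg grB qu qB) grB.1).
exact: isometric_stable h2b hb PQ QP.
Qed.
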